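(* Let $(X,\mathbf h,\Lambda,\widetilde B)$ be a quantum seed. Then every cluster variable of every quantum seed mutation-equivalent to $(X,\mathbf h,\Lambda,\widetilde B)$ lies in $\mathbb{Z}\mathbb{P}[(X'_1)^{\pm1},\dots,(X'_n)^{\pm1}]$ for every quantum seed $(X',\mathbf h,\Lambda',\widetilde B')$ mutation-equivalent to $(X,\mathbf h,\Lambda,\widetilde B)$; that is, $$\mathcal A(X,\mathbf h,\Lambda,\widetilde B)\subseteq \widetilde{\mathcal U}(X,\mathbf h,\Lambda,\widetilde B).$$
   Context: Notation: $[a,b]=\{a,a+1,\dots,b\}$; $[x]_+=\max(x,0)$, applied entrywise to vectors; $e_1,\dots,e_m$ is the standard basis of $\mathbb Z^m$. Fix integers $m\ge n\ge 1$. A compatible pair $(\Lambda,\widetilde B)$ consists of an $m\times n$ integer matrix $\widetilde B=(b_{kl})$ and a skew-symmetric $m\times m$ integer matrix $\Lambda=(\lambda_{kl})$ such that $\Lambda\widetilde B=-\begin{bmatrix}D\\0\end{bmatrix}$ for some $D=\mathrm{diag}(\tilde d_1,\dots,\tilde d_n)$ with all $\tilde d_k\in\mathbb Z_{>0}$ (so $\widetilde B$ has full rank). Write $\Lambda(a,b)=a^T\Lambda b$ for $a,b\in\mathbb Z^m$. Fix positive integers $d_1,\dots,d_n$ such that $d_k$ divides every entry of the $k$-th column $b^k$ of $\widetilde B$ (this divisibility is preserved under mutation), and put $\beta^k=\frac1{d_k}b^k$. The quantum torus $\mathcal T(\Lambda)$ is the $\mathbb Z[q^{\pm1/2}]$-algebra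 with basis $\{X(c)\mid c\in\mathbb Z^m\}$ and multiplication $X(c)X(d)=q^{\frac12\Lambda(c,d)}X(c+d)$; $\mathcal F$ is its skew field of fractions, and $X_k=X(e_k)$. For each $k\in[1,n]$ let $\mathbf h_k=(h_{k,0},\dots,h_{k,d_k})$ with $h_{k,r}\in\mathbb Z[q^{\pm1/2}]$, $h_{k,r}=h_{k,d_k-r}$ and $h_{k,0}=h_{k,d_k}=1$; $\mathbf h=(\mathbf h_1,\dots,\mathbf h_n)$. A quantum seed $(X,\mathbf h,\Lambda,\widetilde B)$ consists of a compatible pair, $\mathbf h$, and a map $X:\mathbb Z^m\to\mathcal F$ with $X(c)X(d)=q^{\frac12\Lambda(c,d)}X(c+d)$ (for the initial seed, the basis of $\mathcal T(\Lambda)$). The mutation in direction $i\in[1,n]$ is $\mu_i(X,\mathbf h,\Lambda,\widetilde B)=(X',\mathbf h,\Lambda',\widetilde B')$ where $\widetilde B'=E\widetilde BF$, $\Lambda'=E^T\Lambda E$, $E$ is the $m\times m$ matrix with $E_{kl}=\delta_{kl}$ for $l\ne i$, $E_{ii}=-1$, $E_{ki}=[-\varepsilon b_{ki}]_+$ for $k\neq i$, and $F$ is the $n\times n$ matrix with $F_{kl}=\delta_{kl}$ for $k\neq i$, $F_{ii}=-1$, $F_{il}=[\varepsilon b_{il}]_+$ for $l\ne i$ (the result is independent of $\varepsilon\in\{\pm1\}$); and $X'$ is the map with $X'(c)X'(d)=q^{\frac12\Lambda'(c,d)}X'(c+d)$ determined by $X'(e_k)=X(e_k)$ for $k\neq i$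 and $X'(e_i)=\sum_{r=0}^{d_i}h_{i,r}X(r[\beta^i]_++(d_i-r)[-\beta^i]_+-e_i)$. Write $X'_k=X'(e_k)$. Seeds obtained by finite sequences of mutations are mutation-equivalent; $X'_1,\dots,X'_n$ are the cluster variables of a seed and $X_{n+1},\dots,X_m$ (unchanged by mutation) are frozen variables. $\mathbb P$ is the multiplicative group generated by $q^{1/2},X_{n+1},\dots,X_m$, and $\mathbb{ZP}$ is the ring of Laurent polynomials in $X_{n+1},\dots,X_m$ with coefficients in $\mathbb Z[q^{\pm1/2}]$. For elements $Y_1,\dots,Y_s\in\mathcal F$, $\mathbb{ZP}[Y_1,\dots,Y_s]$ denotes the subring of $\mathcal F$ generated by $\mathbb{ZP}$ and the $Y_k$ (an exponent $\pm1$ means both $Y$ and $Y^{-1}$ are adjoined). The generalized quantum cluster algebra $\mathcal A(X,\mathbf h,\Lambda,\widetilde B)$ is the $\mathbb Z[q^{\pm1/2}]$-subalgebra of $\mathcal F$ generated by all cluster variables of all seeds mutation-equivalent to the given one together with $X_{n+1}^{\pm1},\dots,X_m^{\pm1}$. The generalized quantum upper cluster algebra is $\widetilde{\mathcal U}(X,\mathbf h,\Lambda,\widetilde B)=\bigcap_{(X',\mathbf h,\Lambda',\widetilde B')\sim(X,\mathbf h,\Lambda,\widetilde B)}\mathbb{ZP}[(X'_1)^{\pm1},\dots,(X'_n)^{\pm1}]$. *)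

(* Defs.v *)
(* Generalized quantum cluster algebras, realised inside an
   arbitrary division ring D into which the quantum torus embeds. *)
From HB Require Import structures.
From mathcomp Require Import all_boot all_order all_algebra.
Set Implicit Arguments.
Unset Strict Implicit.
Unset Printing Implicit Defensive.
Import Order.TTheory GRing.Theory Num.Theory.
Local Open Scope ring_scope.

Definition posz (z : int) : int := if z < 0 then 0 else z.

Section QuantumCluster.
Variables (D : unitRingType) (v : D) (n p : nat).
(* m = n + p; indices lshift p k (k : 'I_n) are mutable, rshift n j frozen;
   v plays the role of q^{1/2}. *)

Definition lamform (L : 'M[int]_(n + p)) (c c' : 'rV[int]_(n + p)) : int :=
  (c *m L *m c'^T) 0 0.

(* The map X : Z^m -> D determined by X(e_k) = x k and
   X(c)X(c') = q^{1/2 Lambda(c,c')} X(c+c'):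
   X(c) = q^{-1/2 sum_{k<l} c_k c_l lambda_kl} X_1^{c_1} ... X_m^{c_m}. *)
Definition qmon (L : 'M[int]_(n + p)) (x : 'I_(n + p) -> D)
    (c : 'rV[int]_(n + p)) : D :=
  v ^ (- \sum_(k < n + p) \sum_(l < n + p | (k < l)%N) c 0 k * c 0 l * L k l)
    * \prod_(k < n + p) (x k) ^ (c 0 k).

(* The quantum torus embeds: the monomials q^{j/2} X(c) are Z-linearly
   independent. *)
Definition torus_indep (L : 'M[int]_(n + p)) (x : 'I_(n + p) -> D) : Prop :=
  forall (N : nat) (a : 'I_N -> int) (j : 'I_N -> int)
         (c : 'I_N -> 'rV[int]_(n + p)),
    injective (fun t => (j t, c t)) ->
    \sum_(t < N) (a t)%:~R * (v ^ (j t) * qmon L x (c t)) = 0 ->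
    forall t, a t = 0.

Inductive gen_ring (S : D -> Prop) : D -> Prop :=
  | gr_mem y : S y -> gen_ring S y
  | gr_one : gen_ring S 1
  | gr_opp y : gen_ring S y -> gen_ring S (- y)
  | gr_add y z : gen_ring S y -> gen_ring S z -> gen_ring S (y + z)
  | gr_mul y z : gen_ring S y -> gen_ring S z -> gen_ring S (y * z).

Definition laurent_v (y : D) : Prop :=
  gen_ring (fun z => z = v \/ z = v^-1) y.

Record seed := Seed {
  sx : 'I_(n + p) -> D;
  sL : 'M[int]_(n + p);
  sB : 'M[int]_(n + p, n)
}.

Variables (d : 'I_n -> nat) (h : 'I_n -> nat -> D).

(* E and F, with epsilon = 1 *)
Definition mutE (B : 'M[int]_(n + p, n)) (i : 'I_n) : 'M[int]_(n + p) :=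
  \matrix_(k, l) if l == lshift p i then
                   (if k == lshift p i then -1 else posz (- B k i))
                 else (k == l)%:Z.

Definition mutF (B : 'M[int]_(n + p, n)) (i : 'I_n) : 'M[int]_n :=
  \matrix_(k, l) if k == i then
                   (if l == i then -1 else posz (B (lshift p i) l))
                 else (k == l)%:Z.

Definition exch_vec (B : 'M[int]_(n + p, n)) (i : 'I_n) (r : nat)
    : 'rV[int]_(n + p) :=
  \row_k (r%:Z * posz (B k i %/ (d i)%:Z)%Z
          + (d i - r)%:Z * posz (- (B k i %/ (d i)%:Z)%Z)
          - (k == lshift p i)%:Z).

Definition mutate (i : 'I_n) (s : seed) : seed :=
  let E := mutE (sB s) i in
  Seed (fun k => if k == lshift p i then
                   \sum_(r < (d i).+1) h i r * qmon (sL s) (sx s) (exch_vec (sB s) i r)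
                 else sx s k)
       (E^T *m sL s *m E)
       (E *m sB s *m mutF (sB s) i).

Definition mutseq (s0 : seed) (w : seq 'I_n) : seed :=
  foldl (fun s i => mutate i s) s0 w.

Definition mut_equiv (s0 s : seed) : Prop := exists w, s = mutseq s0 w.

Definition ZP_laurent (s : seed) : D -> Prop :=
  gen_ring (fun y => y = v \/ y = v^-1 \/
                     exists k, y = sx s k \/ y = (sx s k)^-1).

Definition upper_cluster (s0 : seed) (y : D) : Prop :=
  forall s, mut_equiv s0 s -> ZP_laurent s y.

Definition cluster_alg (s0 : seed) : D -> Prop :=
  gen_ring (fun y => y = v \/ y = v^-1 \/
     (exists j : 'I_p, y = sx s0 (rshift n j) \/ y = (sx s0 (rshift n j))^-1) \/
     (exists s (k : 'I_n), mut_equiv s0 s /\ y = sx s (lshift p k))).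

End QuantumCluster.

(* Main.v *)
(* Let T(s) be the quantum torus of a seed s.  Call y bounded at s if it lies in T(s)
   and in T(mu_k s) for all k; cluster variables of s are bounded at s, so it suffices
   that boundedness is preserved by a mutation mu_i.  Since mu_i is an involution, this
   amounts to y in T(mu_j mu_i s) for j <> i.
   Comparing lowest powers of the variable x_j, an element of T(s) and T(mu_j s) lies
   in the ring J(s) generated by both x_j, x_j' and the other x_k^{+-1}.  Mutating s to
   s' = mu_i s, the exchange relations give x_i, x_j' in J(s'), so y x_i^M is in J(s')
   for some M.  The ring J(s') is graded by l = +-Lambda'(e_i, .), and for the right sign
   the l-lowest term of x_i is a monomial invertible in J(s'); hence x_i can be cancelled
   one power at a time within T(s'), and y is in J(s'), which is contained in T(mu_j s'). *)
Require Import Defs.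
From HB Require Import structures.
From mathcomp Require Import all_boot all_order all_algebra.
From mathcomp Require Import ring zify.
From Stdlib Require Import FunctionalExtensionality.
Import Order.TTheory GRing.Theory Num.Theory.
Set Implicit Arguments.
Unset Strict Implicit.
Unset Printing Implicit Defensive.
Local Open Scope ring_scope.

(** About [D] only this is known: it is a division ring and contains the initial quantum torus. So
    supports are the only tool. Every degree comparison takes the form: an element spanned by two
    disjoint sets of monomials of one seed is zero. For this the independence of the monomials has
    to be carried from the initial seed to all others, and that is the bulk of the work on a single
    mutation. Cancelling $x_i$ is the delicate point, because $yx_i\in J(s')$ says nothing formal
    about $y$. The grading $\Lambda'(e_i,\cdot)$ is chosen because it vanishes on $\beta^j$ for
    $j\ne i$, so that all terms of $x_j'$ have one degree and $J(s')$ is graded, while it is nonzero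
    on $\beta^i$, so that the terms of $x_i$ have distinct degrees. Of the two end monomials of
    $x_i$, both with coefficient $1$, at least one is free of $x_j$ and hence invertible in $J(s')$;
    the sign of the grading makes that one the lowest. *)

Section AdditiveSpan.
Variable R : nzRingType.
Implicit Types (S : R -> Prop) (x y z : R).

(** Statements about supports are spans of predicates, so that they are proved by induction without
    naming coefficients. Explicit sums occur only where linear independence is used. *)
Inductive aspan S : R -> Prop :=
  | aspan_zero : aspan S 0
  | aspan_mem y : S y -> aspan S y
  | aspan_opp y : aspan S y -> aspan S (- y)
  | aspan_add y z : aspan S y -> aspan S z -> aspan S (y + z).

Lemma aspan_sub S y z : aspan S y -> aspan S z -> aspan S (y - z).
Proof. by move=> Sy Sz; apply: aspan_add => //; apply: aspan_opp. Qed.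

Lemma aspan_le S S' y : (forall z, S z -> aspan S' z) -> aspan S y -> aspan S' y.
Proof.
move=> leS; elim=> [|z /leS //|z _ Sz|z1 z2 _ S1 _ S2].
- exact: aspan_zero.
- exact: aspan_opp.
- exact: aspan_add.
Qed.

Lemma aspan_sum S (I : Type) (r : seq I) (F : I -> R) :
  (forall i, aspan S (F i)) -> aspan S (\sum_(i <- r) F i).
Proof.
move=> SF; elim: r => [|i r IH]; first by rewrite big_nil; apply: aspan_zero.
by rewrite big_cons; apply: aspan_add.
Qed.

Lemma aspan_split S S1 S2 y :
  (forall z, S z -> S1 z \/ S2 z) -> aspan S y ->
  exists y1 y2, [/\ y = y1 + y2, aspan S1 y1 & aspan S2 y2].
Proof.
move=> sS; elim=> [|z /sS[S1z|S2z]|z _ [z1 [z2 [-> S1z S2z]]]|].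
- by exists 0, 0; rewrite addr0; split; first by []; apply: aspan_zero.
- by exists z, 0; rewrite addr0; split=> //; [apply: aspan_mem|apply: aspan_zero].
- by exists 0, z; rewrite add0r; split=> //; [apply: aspan_zero|apply: aspan_mem].
- by exists (- z1), (- z2); rewrite opprD; split=> //; apply: aspan_opp.
move=> _ _ _ [y1 [y2 [-> ? ?]]] _ [z1 [z2 [-> ? ?]]].
by exists (y1 + z1), (y2 + z2); rewrite addrACA; split=> //; apply: aspan_add.
Qed.

Lemma aspan_mulr S S' x y :
  (forall z, S z -> aspan S' (z * x)) -> aspan S y -> aspan S' (y * x).
Proof.
move=> SS'; elim=> [|z /SS' //|z _ Sz|z1 z2 _ S1 _ S2].
- by rewrite mul0r; apply: aspan_zero.
- by rewrite mulNr; apply: aspan_opp.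
- by rewrite mulrDl; apply: aspan_add.
Qed.

Lemma aspan_mull S S' x y :
  (forall z, S z -> aspan S' (x * z)) -> aspan S y -> aspan S' (x * y).
Proof.
move=> SS'; elim=> [|z /SS' //|z _ Sz|z1 z2 _ S1 _ S2].
- by rewrite mulr0; apply: aspan_zero.
- by rewrite mulrN; apply: aspan_opp.
- by rewrite mulrDr; apply: aspan_add.
Qed.

Lemma aspan_mul S1 S2 S y z :
  (forall y z, S1 y -> S2 z -> aspan S (y * z)) ->
  aspan S1 y -> aspan S2 z -> aspan S (y * z).
Proof.
move=> SS S1y S2z; apply: aspan_mulr S1y => t S1t.
by apply: aspan_mull S2z => u S2u; apply: SS.
Qed.

End AdditiveSpan.

Section GeneratedRing.
Variable R : unitRingType.
Implicit Types (S : R -> Prop) (x y z : R).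

Lemma gen_ring_le S S' y :
  (forall z, S z -> gen_ring S' z) -> gen_ring S y -> gen_ring S' y.
Proof.
move=> leS; elim=> [z /leS //||z _ Sz|z1 z2 _ S1 _ S2|z1 z2 _ S1 _ S2].
- exact: gr_one.
- exact: gr_opp.
- exact: gr_add.
- exact: gr_mul.
Qed.

Lemma gen_ring0 S : gen_ring S 0.
Proof. by rewrite -(subrr 1); apply: gr_add; [|apply: gr_opp]; apply: gr_one. Qed.

Lemma gen_ring_sub S y z : gen_ring S y -> gen_ring S z -> gen_ring S (y - z).
Proof. by move=> Sy Sz; apply: gr_add => //; apply: gr_opp. Qed.

Lemma gen_ringX S y k : gen_ring S y -> gen_ring S (y ^+ k).
Proof.
move=> Sy; elim: k => [|k IH]; first by rewrite expr0; apply: gr_one.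
by rewrite exprS; apply: gr_mul.
Qed.

Lemma gen_ring_expz S y (k : int) :
  gen_ring S y -> gen_ring S y^-1 -> gen_ring S (y ^ k).
Proof.
case: k => k Sy Sy'; first exact: (gen_ringX k Sy).
by rewrite NegzE -exprnN -exprVn; apply: gen_ringX.
Qed.

Lemma gen_ring_sum S (I : Type) (r : seq I) (F : I -> R) :
  (forall i, gen_ring S (F i)) -> gen_ring S (\sum_(i <- r) F i).
Proof.
move=> SF; elim: r => [|i r IH]; first by rewrite big_nil; apply: gen_ring0.
by rewrite big_cons; apply: gr_add.
Qed.

Lemma gen_ring_prod S (I : Type) (r : seq I) (F : I -> R) :
  (forall i, gen_ring S (F i)) -> gen_ring S (\prod_(i <- r) F i).
Proof.
move=> SF; elim: r => [|i r IH]; first by rewrite big_nil; apply: gr_one.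
by rewrite big_cons; apply: gr_mul.
Qed.

Lemma gen_ring_aspan S y : aspan (gen_ring S) y -> gen_ring S y.
Proof.
elim=> [|//|z _ Sz|z1 z2 _ S1 _ S2]; first exact: gen_ring0.
- exact: gr_opp.
- exact: gr_add.
Qed.

End GeneratedRing.

(** * Normal forms of integer combinations and disjoint supports *)

Section IndexedSpan.
Variables (R : nzRingType) (K : choiceType) (f : K -> R).

Lemma big_sub_uniq (F : K -> R) (s1 s : seq K) :
  uniq s1 -> uniq s -> {subset s1 <= s} -> (forall k, k \notin s1 -> F k = 0) ->
  \sum_(k <- s1) F k = \sum_(k <- s) F k.
Proof.
move=> u1 u s1s F0; rewrite (bigID (mem s1) predT) /= [X in _ = X](bigID (mem s1)) /=.
rewrite [X in _ = _ + X]big1 ?addr0; last by move=> i /F0.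
rewrite [X in _ + X]big1 ?addr0; last by move=> i /F0.
rewrite -[LHS]big_filter -[RHS]big_filter; apply: perm_big; apply: uniq_perm.
- exact: filter_uniq.
- exact: filter_uniq.
by move=> k; rewrite !mem_filter /=; case: (boolP (k \in s1)) => // /s1s ->.
Qed.

(** The coefficient function is total and zero off [s], so two expansions can be added over the
    union of their index lists. *)
Lemma aspan_normal (P : K -> Prop) y :
  aspan (fun y => exists2 k, P k & y = f k) y ->
  exists (s : seq K) (a : K -> int),
    [/\ uniq s, forall k, k \in s -> P k, forall k, k \notin s -> a k = 0
      & y = \sum_(k <- s) (a k)%:~R * f k].
Proof.
elim=> [|z [k Pk ->]|z _ [s [a [us Ps a0 ->]]]|].
- by exists [::], (fun=> 0); rewrite big_nil.
- exists [:: k], (fun k' => (k' == k)%:Z); rewrite big_seq1 eqxx mul1r; split=> //.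
    by move=> k'; rewrite inE => /eqP ->.
  by move=> k'; rewrite inE => /negbTE ->.
- exists s, (fun k => - a k); split=> //; first by move=> k /a0 ->; rewrite oppr0.
  by rewrite -sumrN; apply: eq_bigr => k _; rewrite rmorphN mulNr.
move=> _ _ _ [s [a [us Ps a0 ->]]] _ [r [b [ur Pr b0 ->]]].
exists (undup (s ++ r)), (fun k => a k + b k); split.
- exact: undup_uniq.
- by move=> k; rewrite mem_undup mem_cat => /orP[/Ps|/Pr].
- by move=> k; rewrite mem_undup mem_cat negb_or => /andP[/a0 -> /b0 ->].
rewrite (@big_sub_uniq _ s (undup (s ++ r))) ?undup_uniq //; first last.
- by move=> k /a0 ->; rewrite mul0r.
- by move=> k ks; rewrite mem_undup mem_cat ks.
rewrite (@big_sub_uniq _ r (undup (s ++ r))) ?undup_uniq //; first last.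
- by move=> k /b0 ->; rewrite mul0r.
- by move=> k ks; rewrite mem_undup mem_cat ks orbT.
by rewrite -big_split; apply: eq_bigr => k _; rewrite rmorphD mulrDl.
Qed.

(** The difference of the two normal forms is a relation over the union of the supports; at an index
    of the first one its coefficient is just [a k], which independence makes zero. *)
Lemma aspan_disjoint (P Q : K -> Prop) y :
  (forall (s : seq K) (a : K -> int), uniq s ->
     \sum_(k <- s) (a k)%:~R * f k = 0 -> forall k, k \in s -> a k = 0) ->
  (forall k, P k -> Q k -> False) ->
  aspan (fun y => exists2 k, P k & y = f k) y ->
  aspan (fun y => exists2 k, Q k & y = f k) y -> y = 0.
Proof.
move=> indep PQ /aspan_normal[s [a [us Ps a0 ->]]].
move=> /aspan_normal[r [b [ur Qr b0 eq_ab]]].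
have /indep ab0 : uniq (undup (s ++ r)) by apply: undup_uniq.
rewrite big_seq big1 // => k ks.
suff -> : a k = 0 by rewrite mul0r.
have <- : a k - b k = a k.
  by rewrite b0 ?subr0 //; apply/negP => /Qr; apply: PQ; apply: Ps.
apply: (ab0 (fun k => a k - b k)); last by rewrite mem_undup mem_cat ks.
under eq_bigr do rewrite rmorphB mulrBl.
rewrite sumrB; apply/eqP; rewrite subr_eq0; apply/eqP.
rewrite -(@big_sub_uniq _ s (undup (s ++ r))) ?undup_uniq //; first last.
- by move=> l /a0 ->; rewrite mul0r.
- by move=> l ls; rewrite mem_undup mem_cat ls.
rewrite -(@big_sub_uniq _ r (undup (s ++ r))) ?undup_uniq //.
- by move=> l lr; rewrite mem_undup mem_cat lr orbT.
- by move=> l /b0 ->; rewrite mul0r.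
Qed.

End IndexedSpan.

(** * The skew form on exponent vectors *)

Section BilinearForm.
Variables (n p : nat) (L : 'M[int]_(n + p)).
Implicit Types c : 'rV[int]_(n + p).

Lemma lamformDl c1 c2 c : lamform L (c1 + c2) c = lamform L c1 c + lamform L c2 c.
Proof. by rewrite /lamform !mulmxDl mxE. Qed.

Lemma lamformDr c c1 c2 : lamform L c (c1 + c2) = lamform L c c1 + lamform L c c2.
Proof. by rewrite /lamform linearD /= mulmxDr mxE. Qed.

Lemma lamformZl a c1 c : lamform L (a *: c1) c = a * lamform L c1 c.
Proof. by rewrite /lamform -!scalemxAl mxE. Qed.

Lemma lamformZr a c c1 : lamform L c (a *: c1) = a * lamform L c c1.
Proof. by rewrite /lamform linearZ /= -scalemxAr mxE. Qed.

Lemma lamformNr c c1 : lamform L c (- c1) = - lamform L c c1.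
Proof. by rewrite -scaleN1r lamformZr mulN1r. Qed.

Lemma lamform0l c : lamform L 0 c = 0.
Proof. by rewrite /lamform !mul0mx mxE. Qed.

Lemma lamform0r c : lamform L c 0 = 0.
Proof. by rewrite /lamform trmx0 mulmx0 mxE. Qed.

Lemma lamform_sumr (I : Type) (r : seq I) (F : I -> 'rV[int]_(n + p)) c :
  lamform L c (\sum_(i <- r) F i) = \sum_(i <- r) lamform L c (F i).
Proof.
elim: r => [|i r IH]; first by rewrite !big_nil lamform0r.
by rewrite !big_cons lamformDr IH.
Qed.

Lemma lamform_delta k l : lamform L (delta_mx 0 k) (delta_mx 0 l) = L k l.
Proof. by rewrite /lamform -rowE trmx_delta -colE !mxE. Qed.

Hypothesis skewL : L^T = - L.

Lemma lamformC c1 c2 : lamform L c1 c2 = - lamform L c2 c1.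
Proof.
rewrite /lamform; transitivity ((c1 *m L *m c2^T)^T 0 0); first by rewrite [RHS]mxE.
by rewrite !trmx_mul trmxK skewL mulmxA mulmxN mulNmx [LHS]mxE.
Qed.

Lemma lamformcc c : lamform L c c = 0.
Proof. by have := lamformC c c; lia. Qed.

End BilinearForm.

Lemma lamform_mul n p (L E : 'M[int]_(n + p)) c1 c2 :
  lamform (E^T *m L *m E) c1 c2 = lamform L (c1 *m E^T) (c2 *m E^T).
Proof. by rewrite /lamform trmx_mul trmxK !mulmxA. Qed.

(** * Quantum torus relations and supports inside a division ring *)

Section TorusFrame.
Variables (D : unitRingType) (v : D) (n p : nat).
Hypothesis divD : forall y : D, y != 0 -> y \is a GRing.unit.
Hypothesis v_unit : v \is a GRing.unit.
Local Notation vec := 'rV[int]_(n + p).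
Implicit Types (c : vec) (L : 'M[int]_(n + p)) (X : vec -> D).
Implicit Types (P : vec -> Prop).

Lemma vexpD (a b : int) : v ^ (a + b) = v ^ a * v ^ b.
Proof. exact: exprzDr. Qed.

Lemma vexp_unit (a : int) : v ^ a \is a GRing.unit.
Proof. exact: unitrXz. Qed.

Lemma vexpVK (a : int) : v ^ (- a) * v ^ a = 1.
Proof. by rewrite -vexpD addNr expr0z. Qed.

(** Stated for an arbitrary map [X] rather than for [qmon], so that a formula for the mutated
    monomials can be checked first and identified with [qmon] afterwards. *)
Record frame L X : Prop := Frame {
  frame_comm : forall c, v * X c = X c * v;
  frame_zero : X 0 = 1;
  frame_mul : forall c c', X c * X c' = v ^ lamform L c c' * X (c + c')
}.

(** The combinations over $\mathbb Z[q^{\pm1/2}]$ of monomials with exponent in [P]; the first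
    component of an index is the power of [v]. *)
Definition mspan X P := aspan (fun y => exists2 k : int * vec, P k.2 & y = v ^ k.1 * X k.2).

(** Linear independence of the monomials over $\mathbb Z[q^{\pm1/2}]$, in the form in which it is
    applied and transported along mutations. *)
Definition mindep X := forall P Q, (forall c, P c -> Q c -> False) ->
  forall y, mspan X P y -> mspan X Q y -> y = 0.

Lemma mspan_le X P Q y : (forall c, P c -> Q c) -> mspan X P y -> mspan X Q y.
Proof.
move=> PQ; apply: aspan_le => _ [[j c] Pc ->]; apply: aspan_mem.
by exists (j, c) => //; apply: PQ.
Qed.

Lemma mspan_mem X P c : P c -> mspan X P (X c).
Proof. by move=> Pc; apply: aspan_mem; exists (0, c); rewrite // expr0z mul1r. Qed.

Lemma mspan_split X P P1 P2 y : (forall c, P c -> P1 c \/ P2 c) -> mspan X P y ->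
  exists y1 y2, [/\ y = y1 + y2, mspan X P1 y1 & mspan X P2 y2].
Proof.
move=> PP; apply: aspan_split => z [[j c] /PP[Pc|Pc] ->]; [left|right];
  by exists (j, c).
Qed.

Lemma mspan_sum X P (I : Type) (r : seq I) (F : I -> D) :
  (forall i, mspan X P (F i)) -> mspan X P (\sum_(i <- r) F i).
Proof. exact: aspan_sum. Qed.

Lemma mspan0 X P : mspan X P 0.
Proof. exact: aspan_zero. Qed.

Lemma mspanN X P y : mspan X P y -> mspan X P (- y).
Proof. exact: aspan_opp. Qed.

Lemma mspanD X P y z : mspan X P y -> mspan X P z -> mspan X P (y + z).
Proof. exact: aspan_add. Qed.

Lemma mspanB X P y z : mspan X P y -> mspan X P z -> mspan X P (y - z).
Proof. exact: aspan_sub. Qed.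

Lemma mspan_v X P y (j : int) : mspan X P y -> mspan X P (v ^ j * y).
Proof.
apply: aspan_mull => z [[k c] Pc ->]; apply: aspan_mem.
by exists (j + k, c); rewrite // mulrA vexpD.
Qed.

Lemma mspan_mon X P c (j : int) : P c -> mspan X P (v ^ j * X c).
Proof. by move=> Pc; apply/mspan_v/mspan_mem. Qed.

Lemma mspan_mulr X X' P Q x y : (forall c, P c -> mspan X' Q (X c * x)) ->
  mspan X P y -> mspan X' Q (y * x).
Proof.
move=> PQ; apply: aspan_mulr => _ [[j c] Pc ->].
by rewrite -mulrA; apply/mspan_v/PQ.
Qed.

Lemma mspan_trans X X' P Q y : (forall c, P c -> mspan X' Q (X c)) ->
  mspan X P y -> mspan X' Q y.
Proof. by move=> PQ Py; rewrite -[y]mulr1; apply: mspan_mulr Py => c; rewrite mulr1; apply: PQ. Qed.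

Lemma mspan_laurent X P a y : laurent_v v a -> mspan X P y -> mspan X P (a * y).
Proof.
move=> la; elim: la y => {a} [a [->|->]|y|a _ IH y|a b _ IHa _ IHb y|a b _ IHa _ IHb y] Py.
- by rewrite -[v]expr1z; apply: mspan_v.
- by rewrite -exprN1; apply: mspan_v.
- by rewrite mul1r.
- by rewrite mulNr; apply: aspan_opp; apply: IH.
- by rewrite mulrDl; apply: aspan_add; [apply: IHa|apply: IHb].
- by rewrite -mulrA; apply/IHa/IHb.
Qed.

Lemma laurent_comm a y : laurent_v v a -> v * y = y * v -> a * y = y * a.
Proof.
move=> la vy; elim: la => {a} [a [->|->//]||a _ IH|a b _ IHa _ IHb|a b _ IHa _ IHb].
- exact: vy.
- exact/commr_sym/commrV/commr_sym.
- by rewrite mulr1 mul1r.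
- by rewrite mulrN mulNr IH.
- by rewrite mulrDr mulrDl IHa IHb.
- by rewrite -mulrA IHb mulrA IHa mulrA.
Qed.

Section OneFrame.
Variables (L : 'M[int]_(n + p)) (X : vec -> D).
Hypothesis frX : frame L X.

Lemma frame_commv c (j : int) : X c * v ^ j = v ^ j * X c.
Proof. by apply/commrXz/esym/(frame_comm frX). Qed.

Lemma frame_vmul (i j : int) c c' :
  (v ^ i * X c) * (v ^ j * X c') = v ^ (i + j + lamform L c c') * X (c + c').
Proof.
by rewrite mulrA -(mulrA (v ^ i)) frame_commv -!mulrA (frame_mul frX) !mulrA -!vexpD.
Qed.

Lemma frame_add c c' : X (c + c') = v ^ (- lamform L c c') * (X c * X c').
Proof. by rewrite (frame_mul frX) mulrA vexpVK mul1r. Qed.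

Lemma frame_unit c : X c \is a GRing.unit.
Proof.
apply: divD; apply/eqP => Xc0; have := frame_mul frX c (- c).
rewrite Xc0 mul0r subrr (frame_zero frX) mulr1 => v0.
by have := vexp_unit (lamform L c (- c)); rewrite -v0 unitr0.
Qed.

Lemma frame_inv c : X (- c) = v ^ lamform L c (- c) * (X c)^-1.
Proof.
apply: (mulrI (frame_unit c)); rewrite mulrA frame_commv -mulrA mulrV ?frame_unit //.
by rewrite (frame_mul frX) subrr (frame_zero frX) mulr1.
Qed.

Lemma frame_swap c c' : L^T = - L ->
  X c * X c' = v ^ (lamform L c c' *+ 2) * (X c' * X c).
Proof.
move=> skewL; rewrite !(frame_mul frX) mulrA -vexpD (addrC c').
by congr (v ^ _ * _); rewrite (lamformC skewL c' c); ring.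
Qed.

Lemma mspan_mul P Q S y z :
  (forall c c', P c -> Q c' -> S (c + c')) ->
  mspan X P y -> mspan X Q z -> mspan X S (y * z).
Proof.
move=> PQS; apply: aspan_mul => _ _ [[i c] Pc ->] [[j c'] Qc' ->] /=.
by rewrite frame_vmul; apply: mspan_mon; apply: PQS.
Qed.

Lemma frameX c k : L^T = - L -> X (k%:Z *: c) = X c ^+ k.
Proof.
move=> skewL; elim: k => [|k IH]; first by rewrite scale0r (frame_zero frX).
rewrite exprS intS scalerDl scale1r frame_add lamformZr lamformcc // mulr0.
by rewrite oppr0 expr0z mul1r IH.
Qed.

Lemma frame_expz c (k : int) : L^T = - L -> X (k *: c) = X c ^ k.
Proof.
move=> skewL; case: k => k; first exact: frameX.
rewrite NegzE scaleNr frame_inv frameX // lamformNr lamformZl lamformZr lamformcc //.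
by rewrite !mulr0 oppr0 expr0z mul1r -exprnN.
Qed.

(** Putting $X(e_k)^{c_k}$ in front of the product over the later indices costs
    $\Lambda(c_ke_k,\sum_{l>k}c_le_l)$. These powers of [v] are the ones that [qmon] removes. *)
Lemma frame_prod c (r : seq 'I_(n + p)) : L^T = - L -> sorted ltn (map val r) ->
  \prod_(k <- r) X (delta_mx 0 k) ^ (c 0 k) =
  v ^ (\sum_(k <- r) \sum_(l <- r | (k < l)%N) c 0 k * c 0 l * L k l)
    * X (\sum_(k <- r) c 0 k *: delta_mx 0 k).
Proof.
move=> skewL; elim: r => [|k r IH] /= sr.
  by rewrite !big_nil expr0z mul1r (frame_zero frX).
rewrite !big_cons IH ?(path_sorted sr) // -frame_expz // ltnn.
have ltkr l : l \in r -> (k < l)%N.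
  move=> lr; move: sr; rewrite (path_sortedE ltn_trans) => /andP[/allP/(_ (val l)) kl _].
  by apply: kl; apply: map_f.
rewrite mulrA frame_commv -mulrA (frame_mul frX) mulrA -vexpD.
congr (v ^ _ * _); rewrite addrC; congr (_ + _).
  rewrite lamform_sumr big_seq_cond [RHS]big_seq_cond.
  rewrite [RHS](eq_bigl (fun l => (l \in r) && true)); last first.
    by move=> l /=; case: (boolP (l \in r)) => // /ltkr ->.
  apply: eq_bigr => l _.
  by rewrite lamformZl lamformZr lamform_delta; ring.
rewrite big_seq [RHS]big_seq; apply: eq_bigr => l /ltkr kl.
by rewrite big_cons ltnNge (ltnW kl).
Qed.

(** A frame is determined by its values on the standard basis. *)
Lemma frame_qmon c : L^T = - L -> qmon v L (fun k => X (delta_mx 0 k)) c = X c.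
Proof.
move=> skewL; rewrite /qmon.
have sI : sorted ltn (map val (index_enum 'I_(n + p))).
  have -> : index_enum 'I_(n + p) = enum 'I_(n + p) by rewrite enumT [index_enum _]unlock.
  by rewrite val_enum_ord iota_ltn_sorted.
rewrite frame_prod // mulrA vexpVK mul1r; congr X.
by rewrite [RHS]row_sum_delta.
Qed.

End OneFrame.

Lemma frame_of_qmon L (x : 'I_(n + p) -> D) :
  (forall k, v * x k = x k * v) ->
  (forall c c', qmon v L x c * qmon v L x c' = v ^ lamform L c c' * qmon v L x (c + c')) ->
  frame L (qmon v L x).
Proof.
move=> vx mulX; split=> // [c|].
  apply: commrM; first exact: commrXz.
  by apply: commr_prod => k _; apply/commrXz/vx.
rewrite /qmon big1 ?big1 ?oppr0 ?expr0z ?mulr1 // => k _.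
  by rewrite mxE expr0z.
by rewrite big1 // => l _; rewrite mxE !mul0r.
Qed.

Lemma torus_indep_mindep L (x : 'I_(n + p) -> D) :
  torus_indep v L x -> mindep (qmon v L x).
Proof.
move=> indep P Q PQ y Py Qy.
apply: (aspan_disjoint _ _ Py Qy) => [s a us s0 k ks|k]; last exact: PQ.
have k0 : int * vec by exact: (0, 0).
pose key (t : 'I_(size s)) := nth k0 s t.
have inj : injective (fun t => ((key t).1, (key t).2)).
  move=> t u; rewrite -!surjective_pairing => /eqP.
  by rewrite nth_uniq // => /eqP/val_inj.
have := indep _ (fun t => a (key t)) _ _ inj.
rewrite -(index_mem k s) in ks.
have -> : a k = a (key (Ordinal ks)) by rewrite /key nth_index // -index_mem.
by apply; rewrite -[RHS]s0 (big_nth k0) big_mkord.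
Qed.

End TorusFrame.

Lemma posz_sub (x : int) : posz x - posz (- x) = x.
Proof. by rewrite /posz; case: ltrP => ?; case: ltrP => ?; lia. Qed.

Lemma posz_ge0 (x : int) : 0 <= posz x.
Proof. by rewrite /posz; case: ltrP. Qed.

Lemma divNz_dvd (a b : int) : (b %| a)%Z -> (- a %/ b)%Z = - (a %/ b)%Z.
Proof.
move=> /dvdzP[q ->]; have [->|b0] := eqVneq b 0; first by rewrite !divz0 oppr0.
by rewrite -mulNr !mulzK.
Qed.

(** * Mutation of compatible pairs *)

Section ExchangeMatrix.
Variables (n p : nat) (d : 'I_n -> nat) (t : 'I_n -> int).
Local Notation vec := 'rV[int]_(n + p).
Implicit Types (c : vec) (L : 'M[int]_(n + p)) (B : 'M[int]_(n + p, n)).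
Implicit Types i j : 'I_n.

Hypothesis t_sign : forall i j, 0 < t i * t j.
Hypothesis d_gt0 : forall i, (0 < d i)%N.

Definition bcol B i : vec := \row_k B k i.
Definition bet B i : vec := \row_k (B k i %/ (d i)%:Z)%Z.
(** The map $c\mapsto Ec$ on row vectors. Since $\Lambda'(c,c')=\Lambda(Ec,Ec')$, matrix identities
    become statements about vectors. *)
Definition emap B i c : vec := c *m (mutE B i)^T.
Definition mutL L B i := (mutE B i)^T *m L *m mutE B i.
Definition mutB B i := mutE B i *m B *m mutF B i.

Lemma bcolE B i k : bcol B i 0 k = B k i.
Proof. by rewrite mxE. Qed.

Lemma betE B i k : bet B i 0 k = (B k i %/ (d i)%:Z)%Z.
Proof. by rewrite mxE. Qed.

(** The equation $\Lambda\widetilde B=-[D;0]$ read as a pairing, $\Lambda(c,b^i)=t_ic_i$ with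
    $t=-D$. Of [t] only the common sign of its entries is recorded, and the same [t] serves after
    every mutation. *)
Record compatible L B : Prop := Compatible {
  compat_skew : L^T = - L;
  compat_col : forall i c, lamform L c (bcol B i) = t i * c 0 (lshift p i);
  compat_dvd : forall i k, ((d i)%:Z %| B k i)%Z
}.

Lemma t_neq0 i : t i != 0.
Proof. by have := t_sign i i; case: eqP => // ->; rewrite mulr0. Qed.

Lemma emapE B i c k :
  emap B i c 0 k = if k == lshift p i then - c 0 (lshift p i)
                   else c 0 k + posz (- B k i) * c 0 (lshift p i).
Proof.
rewrite mxE (bigD1 (lshift p i)) //= !mxE eqxx.
case: eqP => [->|/eqP ki].
  rewrite mulrN1 big1 ?addr0 // => l li.
  by rewrite !mxE (negbTE li) eq_sym (negbTE li) mulr0.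
rewrite (bigD1 k) //= !mxE (negbTE ki) eqxx mulr1 big1 ?addr0.
  by rewrite addrC [c _ _ * _]mulrC.
move=> l /andP[li lk]; rewrite !mxE (negbTE li) eq_sym (negbTE lk).
by rewrite mulr0.
Qed.

Lemma emapD B i c1 c2 : emap B i (c1 + c2) = emap B i c1 + emap B i c2.
Proof. exact: mulmxDl. Qed.

Lemma emapZ B i a c : emap B i (a *: c) = a *: emap B i c.
Proof. by rewrite /emap scalemxAl. Qed.

Lemma emapN B i c : emap B i (- c) = - emap B i c.
Proof. exact: mulNmx. Qed.

Lemma emapK B i c : emap B i (emap B i c) = c.
Proof.
apply/rowP => k; rewrite !emapE eqxx; case: (k =P lshift p i) => [->|_]; ring.
Qed.

Lemma emap_id B i c : c 0 (lshift p i) = 0 -> emap B i c = c.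
Proof.
move=> ci; apply/rowP => k; rewrite emapE ci mulr0 addr0 oppr0.
by case: eqP => // ->.
Qed.

Lemma lamform_mutL L B i c1 c2 :
  lamform (mutL L B i) c1 c2 = lamform L (emap B i c1) (emap B i c2).
Proof. exact: lamform_mul. Qed.

Lemma lamform_inj (L1 L2 : 'M[int]_(n + p)) :
  (forall c1 c2, lamform L1 c1 c2 = lamform L2 c1 c2) -> L1 = L2.
Proof. by move=> eqL; apply/matrixP => k l; rewrite -!lamform_delta eqL. Qed.

Section Compatible.
Variables (L : 'M[int]_(n + p)) (B : 'M[int]_(n + p, n)).
Hypothesis cLB : compatible L B.

Let skewL := compat_skew cLB.

Lemma compat_sym i j : t j * B (lshift p j) i = - (t i * B (lshift p i) j).
Proof.
have := lamformC skewL (bcol B i) (bcol B j).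
by rewrite !(compat_col cLB) !mxE.
Qed.

Lemma compat_diag i : B (lshift p i) i = 0.
Proof.
have := lamformcc skewL (bcol B i); rewrite (compat_col cLB) mxE => /eqP.
by rewrite mulf_eq0 (negbTE (t_neq0 i)) => /eqP.
Qed.

(** $t_jb_{ji}=-t_ib_{ij}$ with $t_i,t_j$ of one sign, so $-b_{ji}$ and $b_{ij}$ are positive
    together. *)
Lemma compat_posz i j :
  t j * posz (- B (lshift p j) i) = t i * posz (B (lshift p i) j).
Proof.
have := compat_sym i j; have := t_sign i j.
move: (t i) (t j) (B _ i) (B _ j) => a b x y; rewrite /posz => ab bx.
case: (ltrP y 0) => y0; case: (ltrP (- x) 0) => x0; nia.
Qed.

Lemma bet_scale i : (d i)%:Z *: bet B i = bcol B i.
Proof. by apply/rowP => k; rewrite !mxE mulrC divzK // (compat_dvd cLB). Qed.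

Lemma lamform_bet i c : (d i)%:Z * lamform L c (bet B i) = t i * c 0 (lshift p i).
Proof. by rewrite -lamformZr bet_scale (compat_col cLB). Qed.

Lemma lamform_bet0 i c : c 0 (lshift p i) = 0 -> lamform L c (bet B i) = 0.
Proof.
move=> ci; have := lamform_bet i c; rewrite ci mulr0 => /eqP.
by rewrite mulf_eq0 => /orP[|/eqP //]; have := d_gt0 i; lia.
Qed.

Lemma bet_diag i : bet B i 0 (lshift p i) = 0.
Proof. by rewrite mxE compat_diag div0z. Qed.

(** The usual entrywise rule of matrix mutation; $b_{ii}=0$ removes the remaining terms of
    $E\widetilde BF$. *)
Lemma mutBE i k l :
  mutB B i k l = if (k == lshift p i) || (l == i) then - B k l
    else B k l + posz (- B k i) * B (lshift p i) l + B k i * posz (B (lshift p i) l).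
Proof.
have EB k' l' : (mutE B i *m B) k' l' = if k' == lshift p i then - B k' l'
    else B k' l' + posz (- B k' i) * B (lshift p i) l'.
  transitivity (emap B i (bcol B l') 0 k'); last first.
    by rewrite emapE !mxE; case: eqP => // ->.
  by rewrite !mxE; apply: eq_bigr => m _; rewrite !mxE mulrC.
rewrite [LHS]mxE (bigD1 i) //= EB mxE eqxx compat_diag mulr0 addr0.
case: (l =P i) => [->|/eqP li].
  rewrite orbT big1 ?addr0.
    by case: eqP => [->|_]; rewrite mulrN1 // compat_diag oppr0.
  by move=> m mi; rewrite [mutF _ _ _ _]mxE (negbTE mi) mulr0.
rewrite orbF (bigD1 l) //= EB mxE (negbTE li) eqxx mulr1 big1 ?addr0; last first.
  by move=> m /andP[mi ml]; rewrite [mutF _ _ _ _]mxE (negbTE mi) (negbTE ml) mulr0.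
by case: eqP => [->|_]; rewrite ?compat_diag; ring.
Qed.

(** Because $E^2=1$, applying $E$ to column $j$ of $E\widetilde BF$ leaves column $j$ of $\widetilde
    BF$. *)
Lemma emap_mutB i j : j != i ->
  emap B i (bcol (mutB B i) j) = bcol B j + posz (B (lshift p i) j) *: bcol B i.
Proof.
move=> ji; apply/rowP => k; rewrite emapE [RHS]mxE [X in _ = _ + X]mxE !bcolE !mutBE eqxx (negbTE ji) /=.
case: eqP => [->|_]; first by rewrite compat_diag; ring.
by rewrite /=; ring.
Qed.

Lemma bcol_mutB i : bcol (mutB B i) i = - bcol B i.
Proof. by apply/rowP => k; rewrite [RHS]mxE !bcolE mutBE eqxx orbT. Qed.

Lemma bet_mutB i : bet (mutB B i) i = - bet B i.
Proof.
by apply/rowP => k; rewrite [RHS]mxE !betE mutBE eqxx orbT divNz_dvd // (compat_dvd cLB).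
Qed.

(** For $j\ne i$, $\Lambda'(c,b'^j)=t_j(Ec)_j+[b_{ij}]_+t_i(Ec)_i$, where
    $(Ec)_j=c_j+[-b_{ji}]_+c_i$ and $(Ec)_i=-c_i$. The two multiples of $c_i$ cancel by
    [compat_posz]. *)
Lemma compatible_mut i : compatible (mutL L B i) (mutB B i).
Proof.
split=> [|j c|j k].
- by rewrite /mutL !trmx_mul trmxK skewL mulmxA mulmxN mulNmx.
- rewrite lamform_mutL; case: (j =P i) => [->|/eqP ji].
    rewrite bcol_mutB emapN (@emap_id _ _ (bcol B i)) ?bcolE ?compat_diag // lamformNr.
    by rewrite (compat_col cLB) emapE eqxx; ring.
  rewrite emap_mutB // lamformDr lamformZr !(compat_col cLB) !emapE eqxx.
  rewrite eq_lshift (negbTE ji) mulrDr mulrA compat_posz; ring.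
rewrite mutBE; case: ifP => _; first by rewrite rpredN (compat_dvd cLB).
rewrite !rpredD ?dvdz_mull ?(compat_dvd cLB) //.
by rewrite /posz; case: ifP => _; rewrite ?dvdz0 ?(compat_dvd cLB).
Qed.

End Compatible.

(** The two maps $E$ of a mutation and its return compose to a transvection along $b^i$, not to the
    identity. It preserves $\Lambda$ because $\Lambda(c,b^i)=t_ic_i$, hence [mutL_involutive]. *)
Lemma emap_mut_emap L B i c : compatible L B ->
  emap B i (emap (mutB B i) i c) = c + c 0 (lshift p i) *: bcol B i.
Proof.
move=> cLB; apply/rowP => k; rewrite !emapE eqxx [RHS]mxE [X in _ = _ + X]mxE bcolE.
case: eqP => [->|ki]; first by rewrite (compat_diag cLB) mulr0 addr0 opprK.
rewrite (mutBE cLB) eqxx orbT opprK -[in RHS](posz_sub (B k i)); ring.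
Qed.

Lemma mutB_involutive L B i : compatible L B -> mutB (mutB B i) i = B.
Proof.
move=> cLB; apply/matrixP => k l.
rewrite (mutBE (compatible_mut cLB i)) !(mutBE cLB) eqxx orbT.
case: (k =P lshift p i) => [_|_] /=; first by rewrite opprK.
case: (l =P i) => [_|_] /=; first by rewrite opprK.
rewrite eqxx opprK /=; have := posz_sub (B k i); have := posz_sub (B (lshift p i) l).
move: (posz (B k i)) (posz (- B k i)) (posz (B _ l)) (posz (- B _ l)) => b b' a a' ea eb.
by rewrite -ea -eb; ring.
Qed.

Lemma mutL_involutive L B i : compatible L B -> mutL (mutL L B i) (mutB B i) i = L.
Proof.
move=> cLB; apply: lamform_inj => c1 c2.
rewrite !lamform_mutL !(emap_mut_emap _ _ cLB).
rewrite lamformDl !lamformDr !lamformZl !lamformZr.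
rewrite (lamformC (compat_skew cLB) (bcol B i) c2) !(compat_col cLB).
by rewrite bcolE (compat_diag cLB); ring.
Qed.

(** [emap (- B)] is the map $E$ for the other sign $\varepsilon=-1$; the two differ by a
    transvection along $b^i$, so both give the same $\Lambda'$. *)
Lemma emap_opp L B i c : compatible L B ->
  emap (- B) i c = emap B i c + c 0 (lshift p i) *: bcol B i.
Proof.
move=> cLB; apply/rowP => k; rewrite [RHS]mxE [X in _ = _ + X]mxE bcolE !emapE !mxE.
case: eqP => [->|_]; first by rewrite (compat_diag cLB) mulr0 addr0.
rewrite opprK; have := posz_sub (B k i).
by move: (B k i) (posz (- B k i)) (posz (B k i)) => x b a <-; ring.
Qed.

Lemma mutL_opp L B i : compatible L B -> mutL L (- B) i = mutL L B i.
Proof.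
move=> cLB; apply: lamform_inj => c1 c2; rewrite !lamform_mutL !(emap_opp _ _ cLB).
rewrite lamformDl !lamformDr !lamformZl !lamformZr.
rewrite (lamformC (compat_skew cLB) (bcol B i) (emap B i c2)) !(compat_col cLB).
by rewrite bcolE (compat_diag cLB) !emapE eqxx; ring.
Qed.

(** The exponents of the exchange relation form a segment that starts at $Ee_i=[-b^i]_+-e_i$ and has
    step $\beta^i$. *)
Lemma exch_vecE L B i r : compatible L B -> (r <= d i)%N ->
  exch_vec d B i r = emap B i (delta_mx 0 (lshift p i)) + r%:Z *: bet B i.
Proof.
move=> cLB rd; apply/rowP => k; rewrite [RHS]mxE [X in _ = _ + X]mxE betE emapE !mxE eqxx /=.
case: eqP => [->|/eqP ki].
  by rewrite (compat_diag cLB) div0z oppr0 /posz ltxx !mulr0 !addr0 sub0r ?eqxx.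
rewrite eqxx subr0 mulr1 add0r.
have := compat_dvd cLB i k => /dvdzP[q ->].
rewrite mulzK; last by have := d_gt0 i; lia.
have -> : (d i - r)%:Z = (d i)%:Z - r%:Z by lia.
by rewrite /posz; case: (ltrP q 0) => q0; case: ifP; case: ifP; nia.
Qed.

End ExchangeMatrix.

(** * Integer powers of a q-commuting element *)

Section QCommutation.
Variables (D : unitRingType) (v : D).
Hypothesis v_unit : v \is a GRing.unit.

Lemma qcomm_expz (x y : D) (a k : int) : x \is a GRing.unit ->
  v * x = x * v -> v * y = y * v -> x * y = v ^ a * (y * x) ->
  x ^ k * y = v ^ (a * k) * (y * x ^ k).
Proof.
move=> xU vx vy xy.
have xv (j : int) : x * v ^ j = v ^ j * x by apply/commrXz/esym.
have xXv (m : nat) (j : int) : x ^+ m * v ^ j = v ^ j * x ^+ m.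
  by apply/commrXz/commr_sym/commrX.
have nat_case (m : nat) : x ^+ m * y = v ^ (a * m) * (y * x ^+ m).
  elim: m => [|m IH]; first by rewrite !expr0 mulr0 expr0z !mul1r mulr1.
  rewrite exprS -mulrA IH mulrA xv -!mulrA (mulrA x) xy -!mulrA mulrA -exprzDr //.
  by congr (v ^ _ * _); rewrite intS; ring.
case: k => m; first exact: nat_case.
have xmU : x ^+ m.+1 \is a GRing.unit by rewrite unitrX.
rewrite NegzE -exprnN -exprVn exprVn.
apply: (mulrI xmU); rewrite !mulrA mulrV // mul1r xXv -(mulrA (v ^ _)) nat_case !mulrA.
by rewrite -exprzDr // -!mulrA mulrV // mulr1 mulrN addNr expr0z mul1r.
Qed.

End QCommutation.

(** * Mutation preserves frames and independence of monomials *)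

Section SeedMutation.
Variables (D : unitRingType) (v : D) (n p : nat).
Variables (d : 'I_n -> nat) (h : 'I_n -> nat -> D) (t : 'I_n -> int).
Local Notation vec := 'rV[int]_(n + p).
Local Notation seed := (seed D n p).
Local Notation mu := (mutate v d h).
Implicit Types (c : vec) (s : seed) (P Q : vec -> Prop) (i j : 'I_n).

Hypothesis divD : forall y : D, y != 0 -> y \is a GRing.unit.
Hypothesis v_unit : v \is a GRing.unit.
Hypothesis t_sign : forall i j, 0 < t i * t j.
Hypothesis d_gt0 : forall i, (0 < d i)%N.
Hypothesis h_laurent : forall i r, (r <= d i)%N -> laurent_v v (h i r).
Hypothesis h_ends : forall i, h i 0%N = 1 /\ h i (d i) = 1.
Hypothesis h_sym : forall i r, (r <= d i)%N -> h i r = h i (d i - r)%N.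

(* Locked, so that rewriting with [mulrA] does not look inside a monomial. *)
Definition mon s : vec -> D := locked (qmon v (sL s) (sx s)).

Lemma monE s : mon s = qmon v (sL s) (sx s).
Proof. by rewrite /mon -lock. Qed.
Definition unitv (k : 'I_(n + p)) : vec := delta_mx 0 k.
Local Notation e_ i := (unitv (lshift p i)).

Record valid s : Prop := Valid {
  valid_frame : frame v (sL s) (mon s);
  valid_indep : mindep v (mon s);
  valid_compat : compatible d t (sL s) (sB s)
}.

Lemma unitvE k l : unitv k 0 l = (l == k)%:Z.
Proof. by rewrite mxE eqxx; case: (l == k). Qed.

Lemma mon_unitv s k : mon s (unitv k) = sx s k.
Proof.
rewrite monE /qmon big1 ?oppr0 ?expr0z ?mul1r => [|a _]; last first.
  rewrite big1 // => b ab; rewrite !unitvE.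
  case: (a =P k) => [ak|]; last by rewrite !mul0r.
  by case: (b =P k) => [bk|]; [rewrite ak bk ltnn in ab|rewrite mulr0 mul0r].
have E (r : seq 'I_(n + p)) : uniq r ->
    \prod_(a <- r) sx s a ^ (unitv k 0 a) = if k \in r then sx s k else 1.
  elim: r => [|a r IH] /=; first by rewrite big_nil.
  move=> /andP[ar ur]; rewrite big_cons IH // unitvE inE eq_sym.
  case: (k =P a) => [->|_] /=; last by rewrite expr0z mul1r.
  by rewrite (negbTE ar) mulr1 expr1z.
by rewrite E ?index_enum_uniq // mem_index_enum.
Qed.

Section NewFrame.
Variables (s : seed) (i : 'I_n).
Hypothesis vs : valid s.

Let L := sL s.
Let B := sB s.
Let X := mon s.
Let frX : frame v L X := valid_frame vs.
Let cLB : compatible d t L B := valid_compat vs.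
Let skewL : L^T = - L := compat_skew cLB.
Let b := bet d B i.
Let Ei := emap B i (e_ i).
Let ii := lshift p i.
Let x' := sx (mu i s) ii.

Lemma mut_var : x' = \sum_(r < (d i).+1) h i r * X (Ei + r%:Z *: b).
Proof.
rewrite /x' /= eqxx; apply: eq_bigr => r _.
by rewrite -monE (exch_vecE t_sign d_gt0 cLB) // -ltnS.
Qed.

Lemma emap_unitv_coord : Ei 0 ii = -1.
Proof. by rewrite /Ei /ii emapE eqxx unitvE eqxx. Qed.

Lemma bet_neq0 : b != 0.
Proof.
apply/eqP => b0; have := lamform_bet cLB i (e_ i).
rewrite -/b b0 lamform0r mulr0 unitvE eqxx mulr1 => /esym/eqP.
by rewrite (negbTE (t_neq0 t_sign i)).
Qed.

Lemma mut_var_lead : exists2 w, x' = X Ei + w &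
  mspan v X (fun c => exists2 r : nat, (0 < r)%N & c = Ei + r%:Z *: b) w.
Proof.
rewrite mut_var big_ord_recl /= scale0r addr0 (proj1 (h_ends i)) mul1r.
eexists; first by [].
apply: mspan_sum => r; apply: (mspan_laurent v_unit); first by apply: h_laurent; rewrite /bump.
by apply: mspan_mem; exists (bump 0 r).
Qed.

Lemma mut_var_trail : exists2 w, x' = X (Ei + (d i)%:Z *: b) + w &
  mspan v X (fun c => exists2 r : nat, (r < d i)%N & c = Ei + r%:Z *: b) w.
Proof.
rewrite mut_var big_ord_recr /= (proj2 (h_ends i)) mul1r addrC.
eexists; first by [].
apply: mspan_sum => r; apply: (mspan_laurent v_unit); first by apply: h_laurent; apply: ltnW.
by apply: mspan_mem; exists r.
Qed.

Lemma mut_var_span P : (forall r : nat, (r <= d i)%N -> P (Ei + r%:Z *: b)) ->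
  mspan v X P x'.
Proof.
move=> PE; rewrite mut_var; apply: mspan_sum => r.
have rd : (r <= d i)%N by rewrite -ltnS.
by apply: (mspan_laurent v_unit); [apply: h_laurent|apply/mspan_mem/PE].
Qed.

(** $\beta^i\ne0$, so the first monomial, with coefficient $1$, cannot cancel against the others and
    $x'\ne0$. *)
Lemma mut_var_unit : x' \is a GRing.unit.
Proof.
apply: divD; apply/eqP => x0; have [w xw Pw] := mut_var_lead.
suff X0 : X Ei = 0 by have := frame_unit divD v_unit frX Ei; rewrite X0 unitr0.
apply: (valid_indep vs (P := fun c => c = Ei) (Q := fun c => c <> Ei)) => //.
  exact: mspan_mem.
have -> : X Ei = - w by apply/eqP; rewrite -addr_eq0 -xw x0.
apply: mspanN; apply: mspan_le Pw => c [r r0 ->] /eqP.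
rewrite -[X in _ == X]addr0 (inj_eq (addrI _)) scalemx_eq0 (negbTE bet_neq0) orbF.
by rewrite eqz_nat; case: r r0.
Qed.

Lemma mut_var_commv : v * x' = x' * v.
Proof.
rewrite mut_var mulr_sumr mulr_suml; apply: eq_bigr => r _.
have rd : (r <= d i)%N by rewrite -ltnS.
rewrite -mulrA -(frame_comm frX) !mulrA; congr (_ * _); apply/esym.
exact: (laurent_comm (h_laurent rd)).
Qed.

(** All terms of $x'$ pick up the same power of [v], since $\Lambda(\beta^i,c)=0$ when $c_i=0$. *)
Lemma mut_var_swap c : c 0 ii = 0 ->
  x' * X c = v ^ (lamform L Ei c *+ 2) * (X c * x').
Proof.
move=> ci; rewrite mut_var mulr_suml !mulr_sumr; apply: eq_bigr => r _.
have rd : (r <= d i)%N by rewrite -ltnS.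
have hc := laurent_comm (h_laurent rd).
rewrite -mulrA (frame_swap v_unit frX) // lamformDl lamformZl.
rewrite (lamformC skewL b) (lamform_bet0 d_gt0 cLB) // oppr0 mulr0 addr0.
rewrite (mulrA (X c) (h i r)) -[X c * h i r]hc ?(frame_comm frX) //.
rewrite !mulrA; congr (_ * _ * _).
by apply/hc/commr_sym/commr_sym/commrXz.
Qed.

Definition restr c : vec := c - c 0 ii *: e_ i.

Lemma restr_coord c : restr c 0 ii = 0.
Proof. by rewrite !mxE !eqxx mulr1 subrr. Qed.

Lemma restrD c1 c2 : restr (c1 + c2) = restr c1 + restr c2.
Proof. by rewrite /restr mxE scalerDl opprD addrACA. Qed.

Lemma restr_id c : c 0 ii = 0 -> restr c = c.
Proof. by move=> ci; rewrite /restr ci scale0r subr0. Qed.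

Lemma emap_restr c : emap B i c = restr c + c 0 ii *: Ei.
Proof.
rewrite -[in LHS](subrK (c 0 ii *: e_ i) c) emapD emapZ; congr (_ + _).
exact/emap_id/restr_coord.
Qed.

(** The mutated monomial with $x_i'$ moved to the right; the power of [v] comes from
    $\Lambda'(c-c_ie_i,c_ie_i)=c_i\Lambda(c-c_ie_i,Ee_i)$. *)
Definition new_mon c : D :=
  v ^ (- (lamform L (restr c) Ei * c 0 ii)) * X (restr c) * x' ^ (c 0 ii).

Lemma new_mon_frame : frame v (sL (mu i s)) new_mon.
Proof.
have vX c : v * X c = X c * v by exact: (frame_comm frX).
split=> [c||c1 c2].
- apply: commrM; last exact/commrXz/mut_var_commv.
  by apply: commrM; [apply: commrXz|apply: vX].
- rewrite /new_mon restr_id ?mxE // lamform0l mul0r oppr0 !expr0z (frame_zero frX).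
  by rewrite !mul1r.
rewrite /new_mon restrD mxE.
set a1 := c1 0 ii; set a2 := c2 0 ii; set r1 := restr c1; set r2 := restr c2.
have xv (a j : int) : x' ^ a * v ^ j = v ^ j * x' ^ a.
  by apply/commrXz/commr_sym/commrXz/mut_var_commv.
have xX : x' ^ a1 * X r2 = v ^ (lamform L Ei r2 *+ 2 * a1) * (X r2 * x' ^ a1).
  apply: qcomm_expz => //; first exact: mut_var_unit.
    exact: mut_var_commv.
  by apply/mut_var_swap/restr_coord.
rewrite -!mulrA (mulrA (x' ^ a1)) xv -(mulrA _ _ (X r2 * _)) (mulrA (x' ^ a1)) xX.
rewrite -!mulrA !(mulrA (X r1)) -(exprzDr mut_var_unit).
rewrite (frame_commv frX) -!(mulrA _ (X r1)) !(mulrA (X r1)) (frame_commv frX).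
rewrite -!(mulrA _ (X r1)) (mulrA (X r1)) (frame_mul frX) !mulrA -!vexpD //.
congr (v ^ _ * _ * _).
rewrite -/(mutL L B i) lamform_mutL !emap_restr -/a1 -/a2 -/r1 -/r2.
clearbody r1 r2; rewrite -/L !lamformDl !lamformDr !lamformZl !lamformZr lamformcc //.
rewrite !(lamformC skewL Ei r2); ring.
Qed.

Lemma new_mon_unitv k : new_mon (unitv k) = sx (mu i s) k.
Proof.
rewrite /new_mon; have [->|ki] := eqVneq k ii.
  rewrite unitvE eqxx mulr1 expr1z.
  have -> : restr (unitv ii) = 0 by rewrite /restr unitvE eqxx scale1r subrr.
  by rewrite lamform0l oppr0 expr0z (frame_zero frX) !mul1r.
have k0 : unitv k 0 ii = 0 by rewrite unitvE eq_sym (negbTE ki).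
rewrite restr_id // k0 mulr0 oppr0 !expr0z mul1r mulr1 [LHS]mon_unitv /=.
by rewrite (negbTE ki).
Qed.

Lemma mut_mon : mon (mu i s) = new_mon.
Proof.
apply: functional_extensionality => c.
rewrite -(frame_qmon divD v_unit new_mon_frame); last first.
  exact: (compat_skew (compatible_mut t_sign cLB i)).
by rewrite monE; congr (qmon _ _ _ _); apply: functional_extensionality => k;
  rewrite new_mon_unitv.
Qed.

Local Notation X' := (mon (mu i s)).

Lemma mut_frame : frame v (sL (mu i s)) X'.
Proof. by rewrite mut_mon; apply: new_mon_frame. Qed.

Lemma mut_mon_id c : c 0 ii = 0 -> X' c = X c.
Proof.
move=> ci; rewrite mut_mon /new_mon restr_id // ci mulr0 oppr0 !expr0z.
by rewrite mul1r mulr1.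
Qed.

(** As $\beta^i_i=0$, $x_i'$ is homogeneous of degree $-1$ in $x_i$: mutation negates this degree on
    nonnegative powers. *)
Lemma mut_varX_span (k : nat) : mspan v X (fun c => c 0 ii = - k%:Z) (x' ^+ k).
Proof.
elim: k => [|k IH].
  by rewrite expr0 -(frame_zero frX); apply: mspan_mem; rewrite mxE oppr0.
have x1 : mspan v X (fun c => c 0 ii = -1) x'.
  apply: (@mut_var_span (fun c => c 0 ii = -1)) => r _ /=.
  by rewrite mxE emap_unitv_coord mxE (bet_diag t_sign cLB) mulr0 addr0.
rewrite exprSr; apply: (mspan_mul v_unit frX _ IH x1).
by move=> c c' ck c'1; rewrite mxE ck c'1 intS opprD addrC.
Qed.

Lemma mut_mon_span c : 0 <= c 0 ii -> mspan v X (fun c' => c' 0 ii = - c 0 ii) (X' c).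
Proof.
case ck: (c 0 ii) => [k|//] _; rewrite mut_mon /new_mon ck -mulrA.
apply: (mspan_v v_unit).
apply: (mspan_mul v_unit frX _ _ (mut_varX_span k)).
  2: exact: (mspan_mem v X (erefl (restr c))).
by move=> _ c2 <- c2k; rewrite mxE restr_coord add0r.
Qed.

(** On a slice of constant degree $a$ in $x_i'$, right division by $x_i'^a$ turns new monomials into
    old ones, up to powers of [v]. *)
Lemma mut_span_div (a : int) P y : mspan v X' (fun c => P c /\ c 0 ii = a) y ->
  mspan v X (fun c => P (c + a *: e_ i)) (y * x' ^ (- a)).
Proof.
apply: (mspan_mulr v_unit) => c [Pc ca].
rewrite mut_mon /new_mon ca -!mulrA -exprzDr ?mut_var_unit // subrr expr0z mulr1.
apply: (mspan_mon v_unit).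
by rewrite -ca /restr subrK.
Qed.

Lemma mspan_mut P y : (forall c, P c -> 0 <= c 0 ii) -> mspan v X' P y ->
  mspan v X (fun c => exists2 c', P c' & c 0 ii = - c' 0 ii) y.
Proof.
move=> P0; apply: (mspan_trans v_unit) => c Pc.
by apply: mspan_le (mut_mon_span (P0 _ Pc)) => c' c'i; exists c.
Qed.

(** Induction on the degree in $x_i'$. The top slices of the two expansions agree, since slices have
    different degrees in $x_i$. After division by a power of $x_i'$ their common value has two
    disjoint supports in the old torus, so it is zero. *)
Lemma mut_indep_bounded (M : nat) P Q y : (forall c, P c -> Q c -> False) ->
  mspan v X' (fun c => P c /\ (0 <= c 0 ii) && (c 0 ii < M%:Z)) y ->
  mspan v X' (fun c => Q c /\ (0 <= c 0 ii) && (c 0 ii < M%:Z)) y -> y = 0.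
Proof.
move=> PQ; elim: M y => [|M IH] y.
  move=> + _; have F c : ~ (P c /\ (0 <= c 0 ii) && (c 0 ii < 0)) by case=> _; lia.
  by elim=> [//|_ [k /F]|z _ ->|z1 z2 _ -> _ ->] //; rewrite ?oppr0 ?addr0.
have split R : mspan v X' (fun c => R c /\ (0 <= c 0 ii) && (c 0 ii < M.+1%:Z)) y ->
    exists y1 y2, [/\ y = y1 + y2, mspan v X' (fun c => R c /\ c 0 ii = M%:Z) y1
      & mspan v X' (fun c => R c /\ (0 <= c 0 ii) && (c 0 ii < M%:Z)) y2].
  apply: mspan_split => c [Rc cM]; have [->|ne] := eqVneq (c 0 ii) M%:Z; first by left.
  by right; split=> //; lia.
move=> /split[y1 [y0 [yE Py1 Py0]]] /split[z1 [z0 [zE Qz1 Qz0]]].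
have yz : y1 - z1 = z0 - y0.
  by apply/eqP; rewrite subr_eq addrAC eq_sym subr_eq addrC -zE yE addrC.
have yz1 : y1 = z1.
  apply/eqP; rewrite -subr_eq0; apply/eqP.
  apply: (valid_indep vs (P := fun c => c 0 ii = - M%:Z)
            (Q := fun c => c 0 ii <> - M%:Z)) => //.
    have T R u : mspan v X' (fun c => R c /\ c 0 ii = M%:Z) u ->
        mspan v X (fun c => c 0 ii = - M%:Z) u.
      by move=> Ru; apply: mspan_le (mspan_mut _ Ru) => [c [c' [_ ->]]|c [_ ->]].
    by apply: mspanB; [apply: T Py1|apply: T Qz1].
  have T R u : mspan v X' (fun c => R c /\ (0 <= c 0 ii) && (c 0 ii < M%:Z)) u ->
      mspan v X (fun c => c 0 ii <> - M%:Z) u.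
    move=> Ru; apply: mspan_le (mspan_mut _ Ru) => [c [c' [_ + ->]]|c [_ /andP[]] //].
    by lia.
  by rewrite yz; apply: mspanB; [apply: T Qz0|apply: T Py0].
have y10 : y1 * x' ^ (- M%:Z) = 0.
  apply: (valid_indep vs (P := fun c => P (c + M%:Z *: e_ i))
    (Q := fun c => Q (c + M%:Z *: e_ i))) => [c||]; first exact: PQ.
    exact: mut_span_div.
  by rewrite yz1; apply: mut_span_div.
have y1_0 : y1 = 0.
  by apply: (mulIr (unitrXz (- M%:Z) mut_var_unit)); rewrite y10 mul0r.
have z1_0 : z1 = 0 by rewrite -yz1.
rewrite yE y1_0 add0r; apply: IH => //.
by move: yz; rewrite y1_0 z1_0 subrr => /eqP; rewrite eq_sym subr_eq0 => /eqP <-.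
Qed.

Lemma mspan_bound (Z : vec -> D) (f : vec -> int) P y : mspan v Z P y ->
  exists N : nat, mspan v Z (fun c => P c /\ `|f c| < N%:Z) y.
Proof.
elim=> [|_ [[j c] Pc ->]|z _ [N Nz]|y1 y2 _ [N1 P1] _ [N2 P2]].
- by exists 0%N; apply: mspan0.
- by exists (absz (f c)).+1; apply: (mspan_mon v_unit); split=> //=; lia.
- by exists N; apply: mspanN.
exists (N1 + N2)%N; apply: mspanD.
  by apply: mspan_le P1 => c [Pc fc]; split=> //; lia.
by apply: mspan_le P2 => c [Pc fc]; split=> //; lia.
Qed.

Lemma mut_indep : mindep v X'.
Proof.
move=> P Q PQ y /(mspan_bound (fun c => c 0 ii))[N Py].
move=> /(mspan_bound (fun c => c 0 ii))[M Qy].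
have frX' := mut_frame.
(* Multiplication by this power of $x_i'$ makes all exponents of $x_i'$ nonnegative in both
   expansions. *)
set e := (N + M)%:Z *: e_ i.
have ei : e 0 ii = (N + M)%:Z by rewrite mxE unitvE eqxx mulr1.
apply: (mulIr (frame_unit divD v_unit frX' e)); rewrite mul0r.
apply: (@mut_indep_bounded ((N + M) + (N + M)) (fun c => P (c - e)) (fun c => Q (c - e))).
- by move=> c; apply: PQ.
- apply: (mspan_mul v_unit frX' _ Py (mspan_mem v X' (erefl e))) => c _ [Pc /= cN] <-.
  by rewrite addrK; split=> //; rewrite mxE ei; move: cN; move: (c 0 ii) => z; clear; lia.
- apply: (mspan_mul v_unit frX' _ Qy (mspan_mem v X' (erefl e))) => c _ [Pc /= cN] <-.
  by rewrite addrK; split=> //; rewrite mxE ei; move: cN; move: (c 0 ii) => z; clear; lia.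
Qed.

Lemma valid_mut : valid (mu i s).
Proof.
split; [exact: mut_frame|exact: mut_indep|exact: (compatible_mut t_sign cLB)].
Qed.

Lemma mut_mon_unitv : X' (e_ i) = x'.
Proof. by rewrite mon_unitv. Qed.

(** Lowest terms multiply. As $\Lambda'(c,c')=\Lambda(Ec,Ec')$, the powers of [v] match and the
    lowest term keeps coefficient $1$. [B0] will be [B] or [- B], one for each end of the exchange
    polynomial. *)
Lemma mut_mon_lead_gen (f : vec -> int) (B0 : 'M[int]_(n + p, n)) u c :
  (forall c1 c2, f (c1 + c2) = f c1 + f c2) ->
  mutL L B0 i = mutL L B i -> x' = X (emap B0 i (e_ i)) + u ->
  mspan v X (fun c' => f (emap B0 i (e_ i)) < f c') u -> 0 <= c 0 ii ->
  exists2 w, X' c = X (emap B0 i c) + w & mspan v X (fun c' => f (emap B0 i c) < f c') w.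
Proof.
move=> fD eqL xu uE; case ck: (c 0 ii) => [k|//] _.
elim: k c ck => [|k IH] c ck.
  by exists 0; [rewrite addr0 mut_mon_id // emap_id|apply: mspan0].
set c1 := c - e_ i.
have c1k : c1 0 ii = k by rewrite !mxE ck !eqxx /=; lia.
have cE : c = c1 + e_ i by rewrite subrK.
have [w cw Pw] := IH _ c1k.
rewrite cE (emapD B0) (frame_add v_unit mut_frame) cw mut_mon_unitv xu.
have -> : sL (mu i s) = mutL L B0 i by rewrite eqL.
rewrite lamform_mutL (frame_add v_unit frX).
set q := v ^ _; rewrite mulrDl !mulrDr -!addrA; eexists; first by [].
have A Y Z S1 S2 y z : mspan v X S1 y -> mspan v X S2 z ->
    (forall c1 c2, S1 c1 -> S2 c2 -> Y < f c1 + f c2) -> Y = Z ->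
    mspan v X (fun c' => Z < f c') (q * (y * z)).
  move=> S1y S2z SS <-; apply: (mspan_v v_unit).
  by apply: (mspan_mul v_unit frX _ S1y S2z) => c2 c3 H1 H2; rewrite fD; apply: SS.
apply: mspanD; [|apply: mspanD].
- apply: (A _ _ _ _ _ _ (mspan_mem v X (erefl (emap B0 i c1))) uE _ (esym (fD _ _))).
  by move=> _ c2 <-; lia.
- apply: (A _ _ _ _ _ _ Pw (mspan_mem v X (erefl (emap B0 i (e_ i)))) _ (esym (fD _ _))).
  by move=> c2 _ + <-; lia.
- by apply: (A _ _ _ _ _ _ Pw uE _ (esym (fD _ _))) => c2 c3; lia.
Qed.

Lemma mut_mon_lead (f : vec -> int) c :
  (forall a c1 c2, f (a *: c1 + c2) = a * f c1 + f c2) -> 0 < f b -> 0 <= c 0 ii ->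
  exists2 w, X' c = X (emap B i c) + w & mspan v X (fun c' => f (emap B i c) < f c') w.
Proof.
move=> fD fb; have [u xu Pu] := mut_var_lead.
apply: (@mut_mon_lead_gen f B u) => //.
  by move=> c1 c2; rewrite -[c1]scale1r fD !mul1r scale1r.
by apply: mspan_le Pu => _ [r r0 ->]; rewrite [Ei + _]addrC fD ltrDr mulr_gt0.
Qed.

Lemma mut_mon_trail (f : vec -> int) c :
  (forall a c1 c2, f (a *: c1 + c2) = a * f c1 + f c2) -> f b < 0 -> 0 <= c 0 ii ->
  exists2 w, X' c = X (emap (- B) i c) + w &
    mspan v X (fun c' => f (emap (- B) i c) < f c') w.
Proof.
move=> fD fb; have [u xu Pu] := mut_var_trail.
have EB : emap (- B) i (e_ i) = Ei + (d i)%:Z *: b.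
  by rewrite (emap_opp t_sign _ _ cLB) (bet_scale cLB) unitvE eqxx scale1r.
apply: (@mut_mon_lead_gen _ (- B) u); rewrite ?EB //.
- by move=> c1 c2; rewrite -[c1]scale1r fD !mul1r scale1r.
- exact: (mutL_opp t_sign i cLB).
apply: mspan_le Pu => _ [r r0 ->]; rewrite ![Ei + _]addrC !fD ltrD2r.
by rewrite ltr_nM2r // ltz_nat.
Qed.

End NewFrame.

(** After right multiplication by $x_i'$ the two sides agree term by term: the returning exchange
    relation runs through the same segment of exponents backwards, which the symmetry of [h]
    compensates. *)
Lemma mut_mut s i : valid s -> mu i (mu i s) = s.
Proof.
move=> vs; have vs' := valid_mut i vs.
have cLB := valid_compat vs; have skewL := compat_skew cLB; have frX := valid_frame vs.
have E : sx (mu i (mu i s)) = sx s; last first.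
  move: E (mutL_involutive t_sign i cLB) (mutB_involutive t_sign i cLB).
  rewrite [mu i (mu i s)]/mutate; case: s vs vs' cLB skewL frX => x L B /= _ _ _ _ _.
  by move=> -> EL EB; congr Seed.
apply: functional_extensionality => k.
have [->|ki] := eqVneq k (lshift p i); last by rewrite /= (negbTE ki).
rewrite (mut_var i vs') -mon_unitv.
set b := bet d (sB s) i; set e := e_ i; set Ei := emap (sB s) i e.
have bE : emap (sB (mu i s)) i e = Ei + (d i)%:Z *: b.
  rewrite /= -/(mutB (sB s) i) -[LHS](emapK (sB s) i) (emap_mut_emap t_sign _ _ cLB).
  rewrite unitvE eqxx scale1r emapD (bet_scale cLB) (@emap_id _ _ _ _ (bcol _ _)) //.
  by rewrite bcolE (compat_diag t_sign cLB).
have bN : bet d (sB (mu i s)) i = - b by exact: (bet_mutB t_sign cLB i).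
have xU := mut_var_unit i vs; have lb := lamform_bet cLB i.
apply: (mulIr xU); rewrite [in RHS](mut_var i vs) mulr_suml mulr_sumr.
rewrite (reindex_inj rev_ord_inj) /=; apply: eq_bigr => r _.
have rd : (r <= d i)%N by rewrite -ltnS.
rewrite subSS -h_sym // bE bN (mut_mon i vs) /new_mon.
set c := _ + _ : vec.
have -> : restr i c = Ei + e + r%:Z *: b.
  rewrite /restr /c scalerN; have -> : (d i - r)%:Z = (d i)%:Z - r%:Z by lia.
  have -> : (Ei + (d i)%:Z *: b - ((d i)%:Z - r%:Z) *: b) = Ei + r%:Z *: b.
    by rewrite scalerBl opprB [X in _ + X]addrC addrA addrK.
  by rewrite mxE emap_unitv_coord // mxE (bet_diag t_sign cLB) mulr0 addr0 scaleN1r opprK addrAC.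
have -> : c 0 (lshift p i) = -1.
  rewrite /c mxE mxE [X in _ + X + _]mxE [X in _ + X]mxE [X in _ + _ * X]mxE.
  by rewrite (bet_diag t_sign cLB) emap_unitv_coord // oppr0 !mulr0 !addr0.
have -> : mon s e * (h i r * mon s (Ei + r%:Z *: b)) =
    h i r * (v ^ lamform (sL s) e (Ei + r%:Z *: b) * mon s (Ei + e + r%:Z *: b)).
  rewrite mulrA -(laurent_comm (h_laurent rd) (frame_comm frX e)) -mulrA.
  by rewrite (frame_mul frX) addrA (addrC e).
rewrite mulrN1 opprK exprN1 -!mulrA mulVr // mulr1.
congr (_ * (v ^ _ * _)).
(* What remains is $\Lambda(\beta^i,Ee_i)=\Lambda(e_i,\beta^i)$, which holds since $Ee_i$ and $e_i$
   have $i$-th coordinates $-1$ and $1$. *)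
rewrite !lamformDl lamformDr lamformcc // add0r lamformZl lamformZr; congr (_ + _ * _).
have d0 : (d i)%:Z != 0 by have := d_gt0 i; lia.
apply: (mulfI d0); rewrite (lamformC skewL) mulrN !lb.
by rewrite emap_unitv_coord // unitvE eqxx mulrN opprK.
Qed.

(** * Spans of monomials as Laurent rings *)

Section CommutationSpan.
Variables (s : seed).
Hypothesis vs : valid s.
Let frX : frame v (sL s) (mon s) := valid_frame vs.

Lemma mon_inv c : (mon s c)^-1 = v ^ (- lamform (sL s) c (- c)) * mon s (- c).
Proof. by rewrite (frame_inv divD v_unit frX) mulrA vexpVK // mul1r. Qed.

Lemma seed_var_unit k : sx s k \is a GRing.unit.
Proof. by rewrite -mon_unitv (frame_unit divD v_unit frX). Qed.

Lemma seed_var_commv k : v * sx s k = sx s k * v.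
Proof. by rewrite -mon_unitv (frame_comm frX). Qed.

Lemma seed_var_qcomm k l : exists a : int, sx s k * sx s l = v ^ a * (sx s l * sx s k).
Proof.
rewrite -!mon_unitv; eexists; apply: (frame_swap v_unit frX).
exact: (compat_skew (valid_compat vs)).
Qed.

Lemma seed_var_inv_qcomm k l :
  exists a : int, (sx s k)^-1 * sx s l = v ^ a * (sx s l * (sx s k)^-1).
Proof.
have [a kl] := seed_var_qcomm k l; exists (a * (-1)).
rewrite -exprN1; apply: (qcomm_expz v_unit (-1) (seed_var_unit k)) => //; exact: seed_var_commv.
Qed.

Local Notation tspan := (mspan v (mon s) (fun _ => True)).

Lemma ZP_laurent_tspan y : ZP_laurent v s y -> tspan y.
Proof.
have T1 : tspan 1 by rewrite -(frame_zero frX); apply: mspan_mem.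
elim=> {y} [y [->|[->|[k [->|->]]]]|//|y _ Ty|y z _ Ty _ Tz|y z _ Ty _ Tz].
- by have := mspan_v v_unit 1 T1; rewrite expr1z mulr1.
- by have := mspan_v v_unit (-1) T1; rewrite exprN1 mulr1.
- by rewrite -mon_unitv; apply: mspan_mem.
- by rewrite -mon_unitv mon_inv; apply: (mspan_mon v_unit).
- exact: mspanN.
- exact: mspanD.
- exact: (mspan_mul v_unit frX _ Ty Tz).
Qed.

Lemma gen_ring_mspan (S : D -> Prop) P y :
  gen_ring S v -> gen_ring S v^-1 ->
  (forall c k, P c -> gen_ring S (sx s k ^ c 0 k)) ->
  mspan v (mon s) P y -> gen_ring S y.
Proof.
move=> Sv Sv' Sx Py; apply: gen_ring_aspan; apply: aspan_le Py => _ [[j c] /= Pc ->].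
apply: aspan_mem; apply: gr_mul; first exact: gen_ring_expz.
rewrite monE; apply: gr_mul; first exact: gen_ring_expz.
by apply: gen_ring_prod => k; apply: Sx.
Qed.

Lemma tspan_ZP_laurent y : tspan y -> ZP_laurent v s y.
Proof.
apply: gen_ring_mspan => [||c k _].
- by apply: gr_mem; left.
- by apply: gr_mem; right; left.
by apply: gen_ring_expz; apply: gr_mem; right; right; exists k; [left|right].
Qed.

End CommutationSpan.

(** * The ring generated by both exchange partners *)

Definition hull s j : D -> Prop :=
  gen_ring (fun y => y = v \/ y = v^-1 \/
    (exists2 k, k != lshift p j & y = sx s k \/ y = (sx s k)^-1) \/
    y = sx s (lshift p j) \/ y = sx (mu j s) (lshift p j)).

Local Notation tspan s := (mspan v (mon s) (fun _ => True)).

Lemma hull_v s j (a : int) : hull s j (v ^ a).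
Proof. by apply: gen_ring_expz; apply: gr_mem; [left|right; left]. Qed.

Lemma hull_side s j k : k != lshift p j -> hull s j (sx s k).
Proof. by move=> kj; apply: gr_mem; right; right; left; exists k => //; left. Qed.

Lemma hull_side_inv s j k : k != lshift p j -> hull s j (sx s k)^-1.
Proof. by move=> kj; apply: gr_mem; right; right; left; exists k => //; right. Qed.

Lemma hull_main s j : hull s j (sx s (lshift p j)).
Proof. by apply: gr_mem; right; right; right; left. Qed.

Lemma hull_mut_main s j : hull s j (sx (mu j s) (lshift p j)).
Proof. by apply: gr_mem; right; right; right; right. Qed.

Lemma hull_laurent s j a : laurent_v v a -> hull s j a.
Proof.
apply: gen_ring_le => _ [->|->]; first by have := hull_v s j 1; rewrite expr1z.
by have := hull_v s j (-1); rewrite exprN1.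
Qed.

Lemma sx_mut_neq s j k : k != lshift p j -> sx (mu j s) k = sx s k.
Proof. by move=> /negbTE kj; rewrite /= kj. Qed.

Lemma hull_mspan s j P y : valid s -> (forall c, P c -> 0 <= c 0 (lshift p j)) ->
  mspan v (mon s) P y -> hull s j y.
Proof.
move=> vs P0; apply: gen_ring_mspan => // [||c k /P0 cj].
- by have := hull_v s j 1; rewrite expr1z.
- by have := hull_v s j (-1); rewrite exprN1.
have [kj|kj] := eqVneq k (lshift p j).
  by rewrite kj; case: (c 0 _) cj => // m _; apply: gen_ringX; apply: hull_main.
by apply: gen_ring_expz; [apply: hull_side|apply: hull_side_inv].
Qed.

Lemma hull_mut s j y : valid s -> hull (mu j s) j y -> hull s j y.
Proof.
move=> vs; apply: gen_ring_le => {y} y.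
rewrite mut_mut // => -[->|[->|[[k kj]|[->|->]]]].
- by have := hull_v s j 1; rewrite expr1z.
- by have := hull_v s j (-1); rewrite exprN1.
- rewrite sx_mut_neq // => -[->|->]; first exact: hull_side.
  exact: hull_side_inv.
- exact: hull_mut_main.
- exact: hull_main.
Qed.

Lemma hull_tspan s j y : valid s -> hull s j y -> tspan s y.
Proof.
move=> vs hy; apply: ZP_laurent_tspan => //; move: hy; apply: gen_ring_le => {y} y.
case=> [->|[->|[[k kj]|[->|->]]]].
- by apply: gr_mem; left.
- by apply: gr_mem; right; left.
- by move=> yk; apply: gr_mem; right; right; exists k.
- by apply: gr_mem; right; right; exists (lshift p j); left.
by apply: tspan_ZP_laurent; apply: mut_var_span.
Qed.

Lemma hull_tspan_mut s j y : valid s -> hull s j y -> tspan (mu j s) y.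
Proof.
move=> vs hy; apply: (hull_tspan (j := j)); first exact: valid_mut.
by apply: hull_mut; [exact: valid_mut|rewrite mut_mut].
Qed.

Lemma mspan_disjoint s P Q y z : valid s -> (forall c, P c -> Q c -> False) ->
  mspan v (mon s) P y -> mspan v (mon s) Q z -> y = z -> y = 0.
Proof. by move=> vs PQ Py Qz yz; apply: (valid_indep vs PQ) => //; rewrite yz. Qed.

(** The part of $y$ with nonnegative powers of $x_i'$ is in the ring already. The rest $w$ has only
    negative powers of $x_i'$ and turns out to have only positive powers of $x_i$. *)
Lemma tspan_adjacent s i y : valid s -> tspan s y -> tspan (mu i s) y -> hull s i y.
Proof.
move=> vs Ty T'y; have vs' := valid_mut i vs.
pose x' := sx (mu i s) (lshift p i); have xU : x' \is a GRing.unit by apply: mut_var_unit.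
have [y1 [w [yE Py1 Pw]]] : exists y1 w, [/\ y = y1 + w,
    mspan v (mon (mu i s)) (fun c => 0 <= c 0 (lshift p i)) y1
    & mspan v (mon (mu i s)) (fun c => c 0 (lshift p i) < 0) w].
  by apply: mspan_split T'y => c _; case: (lerP 0 (c 0 (lshift p i))); [left|right].
have hy1 : hull s i y1 by apply: hull_mut => //; apply: hull_mspan Py1.
have Tw : tspan s w.
  by rewrite -(addKr y1 w) -yE addrC; apply: mspanB => //; apply: hull_tspan hy1.
rewrite yE; apply: gr_add => //.
have [N {}Pw] := mspan_bound (fun c => c 0 (lshift p i)) Pw.
have wx : mspan v (mon s) (fun c => - N%:Z < c 0 (lshift p i)) (w * x' ^+ N).
  have e_i : mon (mu i s) (N%:Z *: e_ i) = x' ^+ N.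
    rewrite (frame_expz divD v_unit (valid_frame vs')) ?mon_unitv //.
    exact: (compat_skew (valid_compat vs')).
  have Pwx : mspan v (mon (mu i s)) (fun c => (0 <= c 0 (lshift p i)) &&
      (c 0 (lshift p i) < N%:Z)) (w * x' ^+ N).
    rewrite -e_i; apply: (mspan_mul v_unit (valid_frame vs') _ Pw
      (mspan_mem v _ (erefl (N%:Z *: e_ i)))) => c _ [c0 /= cN] <-.
    rewrite mxE [X in _ + X]mxE unitvE eqxx mulr1.
    by move: c0 cN; move: (c 0 _) => z; clear; lia.
  apply: mspan_le (mspan_mut vs _ Pwx) => [c [c' + ->]|c /andP[]//].
  by move: (c' 0 _) => z; clear; lia.
have [w1 [w2 [wE Pw1 Pw2]]] : exists w1 w2, [/\ w = w1 + w2,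
    mspan v (mon s) (fun c => 0 < c 0 (lshift p i)) w1
    & mspan v (mon s) (fun c => c 0 (lshift p i) <= 0) w2].
  by apply: mspan_split Tw => c _; case: (lerP (c 0 (lshift p i)) 0); [right|left].
(* The product $wx_i'^N$ has degree above $-N$ in $x_i$, whereas [w2] times $x_i'^N$ has degree at
   most $-N$. *)
have w20 : w2 = 0.
  apply: (mulIr (unitrX N xU)); rewrite mul0r.
  have xN := mut_varX_span i vs N.
  apply: (mspan_disjoint (s := s) (P := fun c => c 0 (lshift p i) <= - N%:Z)
    (Q := fun c => - N%:Z < c 0 (lshift p i)) (z := w * x' ^+ N - w1 * x' ^+ N)) => //.
  - by move=> c; move: (c 0 _) => z; clear; lia.
  - apply: (mspan_mul v_unit (valid_frame vs) _ Pw2 xN) => c c' c0 c'N.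
    by rewrite mxE c'N; move: c0; move: (c 0 _) => z; clear; lia.
  - apply: mspanB => //.
    apply: (mspan_mul v_unit (valid_frame vs) _ Pw1 xN) => c c' c0 c'N.
    by rewrite mxE c'N; move: c0; move: (c 0 _) => z; clear; lia.
  - by rewrite -mulrBl wE addrC addKr.
rewrite wE w20 addr0; apply: hull_mspan Pw1 => // c; exact: ltW.
Qed.

(** * Gradings and cancellation of lowest terms *)

Definition int_linear (f : vec -> int) :=
  forall a c1 c2, f (a *: c1 + c2) = a * f c1 + f c2.

Lemma int_linearD f c1 c2 : int_linear f -> f (c1 + c2) = f c1 + f c2.
Proof. by move=> fl; rewrite -[c1]scale1r fl mul1r scale1r. Qed.

Lemma int_linear0 f : int_linear f -> f 0 = 0.
Proof. by move=> fl; have := int_linearD 0 0 fl; rewrite addr0; lia. Qed.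

(** The only generator with several terms is $x_j'$, and $f(\beta^j)=0$ gives all its terms the same
    degree. *)
Lemma hull_graded s j f y : valid s -> int_linear f -> f (bet d (sB s) j) = 0 ->
  hull s j y ->
  aspan (fun z => hull s j z /\ exists a, mspan v (mon s) (fun c => f c = a) z) y.
Proof.
move=> vs fl fb; have frX := valid_frame vs; have f0 := int_linear0 fl.
have one : mspan v (mon s) (fun c => f c = 0) 1.
  by rewrite -(frame_zero frX); apply: mspan_mem.
elim=> {y} [y Sy||y _ Hy|y z _ Hy _ Hz|y z _ Hy _ Hz].
- apply: aspan_mem; split; first exact: gr_mem.
  case: Sy => [->|[->|[[k _]|[->|->]]]].
  + by exists 0; have := mspan_v v_unit 1 one; rewrite expr1z mulr1.
  + by exists 0; have := mspan_v v_unit (-1) one; rewrite exprN1 mulr1.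
  + case=> ->; first by exists (f (unitv k)); rewrite -mon_unitv; apply: mspan_mem.
    exists (f (- unitv k)); rewrite -mon_unitv mon_inv //.
    exact: (mspan_mon v_unit).
  + by exists (f (e_ j)); rewrite -mon_unitv; apply: mspan_mem.
  exists (f (emap (sB s) j (e_ j))); apply: mut_var_span => // r _.
  by rewrite addrC fl fb mulr0 add0r.
- by apply: aspan_mem; split; [apply: gr_one|exists 0].
- exact: aspan_opp.
- exact: aspan_add.
apply: aspan_mul Hy Hz => {}y {}z [hy [a ya]] [hz [b zb]].
apply: aspan_mem; split; first exact: gr_mul.
exists (a + b); apply: (mspan_mul v_unit frX _ ya zb) => c c' <- <-.
exact: int_linearD.
Qed.

(* Induction on the [f]-lowest component [y0] of [y]: the lowest component of
   [y * z] is [y0 * mon s c0], it lies in the graded ring [hull s j], and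
   [mon s c0] is a unit there. *)
Lemma hull_cancel s j f c0 u y : valid s -> int_linear f ->
  f (bet d (sB s) j) = 0 -> c0 0 (lshift p j) = 0 ->
  mspan v (mon s) (fun c => f c0 < f c) u -> hull s j (mon s c0 + u) ->
  tspan s y -> hull s j (y * (mon s c0 + u)) -> hull s j y.
Proof.
move=> vs fl fb c0j Pu; set z := mon s c0 + u => hz Ty.
have frX := valid_frame vs; have fD := fun c c' => int_linearD c c' fl.
have [N PN] := mspan_bound f Ty.
have {Ty}PN : mspan v (mon s) (fun c => (- N%:Z <= f c) && (f c < - N%:Z + (N + N)%:Z)) y.
  by apply: mspan_le PN => c [_ /=]; move: (f c) => x; clear; lia.
(* The degrees of $y$ lie in a window; its lower end stays free in the induction on its length,
   since removing the lowest component raises it by one. *)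
move: (- N%:Z) (N + N)%N PN => a M; elim: M a y => [|M IH] a y.
  have F c : (a <= f c) && (f c < a + 0%:Z) -> False by lia.
  move=> Py _; suff -> : y = 0 by apply: gen_ring0.
  by elim: Py => [//|_ [k /F]|z' _ ->|z1 z2 _ -> _ ->] //; rewrite ?oppr0 ?addr0.
move=> Py hyz.
have [y0 [y1 [yE P0 P1]]] : exists y0 y1, [/\ y = y0 + y1,
    mspan v (mon s) (fun c => f c = a) y0
    & mspan v (mon s) (fun c => (a + 1 <= f c) && (f c < (a + 1) + M%:Z)) y1].
  apply: mspan_split Py => c; have [->|ne] := eqVneq (f c) a; first by left.
  by move=> H; right; lia.
have [g1 [g2 [gE G1 G2]]] : exists g1 g2, [/\ y * z = g1 + g2,
    aspan (fun x => hull s j x /\ mspan v (mon s) (fun c => f c = a + f c0) x) g1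
    & aspan (fun x => mspan v (mon s) (fun c => f c <> a + f c0) x) g2].
  apply: aspan_split (hull_graded vs fl fb hyz) => x [hx [m xm]].
  have [ma|ma] := eqVneq m (a + f c0).
    by left; split=> //; apply: mspan_le xm => c ->.
  by right; apply: mspan_le xm => c ->; apply/eqP.
have hg1 : hull s j g1 by apply: gen_ring_aspan; apply: aspan_le G1 => x [hx _]; apply: aspan_mem.
have Pg1 : mspan v (mon s) (fun c => f c = a + f c0) g1.
  by apply: aspan_le G1 => x [_ xm].
have Pg2 : mspan v (mon s) (fun c => f c <> a + f c0) g2 by apply: aspan_le G2.
have Pz : mspan v (mon s) (fun c => f c0 <= f c) z.
  apply: mspanD; first by apply: mspan_mem.
  by apply: mspan_le Pu => c /ltW.
have lead : y0 * mon s c0 - g1 = 0.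
  apply: (mspan_disjoint (s := s) (P := fun c => f c = a + f c0)
    (Q := fun c => f c <> a + f c0) (z := g2 - y0 * u - y1 * z)) => //.
  - apply: mspanB => //.
    by apply: (mspan_mul v_unit frX _ P0 (mspan_mem v _ (erefl c0))) => c _ <- <-; apply: fD.
  - apply: mspanB; first apply: mspanB => //.
      apply: (mspan_mul v_unit frX _ P0 Pu) => c c'; rewrite fD.
      by move: (f c) (f c') (f c0); clear; lia.
    apply: (mspan_mul v_unit frX _ P1 Pz) => c c'; rewrite fD.
    by move: (f c) (f c') (f c0); clear; lia.
  have -> : g2 = y * z - g1 by rewrite gE addrC addKr.
  rewrite yE mulrDl [y0 * z]mulrDr; apply/eqP; rewrite eq_sym !subr_eq; apply/eqP.
  by rewrite [RHS](ACl (1*2*5*4*3)) /= subrK.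
have hy0 : hull s j y0.
  have -> : y0 = (y0 * mon s c0) * (mon s c0)^-1.
    by rewrite -mulrA mulrV ?mulr1 // (frame_unit divD v_unit frX).
  move: lead => /eqP; rewrite subr_eq0 => /eqP ->.
  apply: gr_mul => //; rewrite mon_inv //; apply: gr_mul; first exact: hull_v.
  apply: (hull_mspan vs _ (mspan_mem v _ (erefl (- c0)))) => _ <-.
  by rewrite mxE c0j oppr0.
rewrite yE; apply: gr_add => //; apply: IH P1 _.
have -> : y1 * z = y * z - y0 * z by rewrite yE mulrDl addrC addKr.
by apply: gen_ring_sub => //; apply: gr_mul.
Qed.

(** * Comparison of the exchange relations in adjacent seeds *)

Lemma coord_linear k : int_linear (fun c => c 0 k).
Proof. by move=> a c1 c2; rewrite !mxE. Qed.

Lemma bet_entry s i k : valid s -> (d i)%:Z * bet d (sB s) i 0 k = sB s k i.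
Proof. by move=> vs; rewrite -bcolE -(bet_scale (valid_compat vs)) [RHS]mxE. Qed.

Lemma exch_coord_ge0 s i k (r : nat) : valid s -> k != lshift p i -> (r <= d i)%N ->
  0 <= (emap (sB s) i (e_ i) + r%:Z *: bet d (sB s) i) 0 k.
Proof.
move=> vs ki rd; rewrite -(exch_vecE t_sign d_gt0 (valid_compat vs) rd) mxE.
by rewrite (negbTE ki) subr0 addr_ge0 // mulr_ge0 // posz_ge0.
Qed.

Lemma exch_coord_main s i (r : nat) : valid s ->
  (emap (sB s) i (e_ i) + r%:Z *: bet d (sB s) i) 0 (lshift p i) = -1.
Proof.
move=> vs; rewrite mxE emap_unitv_coord // mxE.
by rewrite (bet_diag t_sign (valid_compat vs)) mulr0 addr0.
Qed.

Lemma opposite_sign (a b x y : int) : b * y = - (a * x) -> 0 < a * b -> 0 < x -> y < 0.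
Proof.
move=> byax ab x0; have a0 : a != 0 by apply/eqP => a0; move: ab; rewrite a0 mul0r.
have aay : (a * b) * y = - (a ^+ 2 * x) by rewrite -mulrA byax; ring.
by rewrite -(pmulr_rlt0 _ ab) aay oppr_lt0 mulr_gt0 // exprn_even_gt0.
Qed.

(* The choice of sign makes the old monomial the term of least degree in the
   direction [j] of its expansion in the new seed. *)
Lemma mon_expand_mut s i j : valid s -> j != i ->
  let s' := mu i s in exists B0 : 'M[int]_(n + p, n),
  [/\ emap B0 i (bcol (sB s) j) = bcol (sB s') j, posz (- B0 (lshift p j) i) = 0
    & forall c, 0 <= c 0 (lshift p i) ->
        (sB s (lshift p i) j = 0 -> c 0 (lshift p i) = 0) ->
        exists2 w, mon s c = mon s' (emap B0 i c) + w &
          mspan v (mon s') (fun c' => emap B0 i c 0 (lshift p j) < c' 0 (lshift p j)) w].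
Proof.
move=> vs ji s'; have vs' : valid s' := valid_mut i vs.
have cLB := valid_compat vs; have cLB' := valid_compat vs'.
have Bij : sB s' (lshift p i) j = - sB s (lshift p i) j.
  by rewrite /= (mutBE t_sign cLB) eqxx.
have Bji : sB s' (lshift p j) i = - sB s (lshift p j) i.
  by rewrite /= (mutBE t_sign cLB) eqxx orbT.
have sym := compat_sym cLB i j; have tij := t_sign i j.
have EB : emap (sB s') i (bcol (sB s) j) =
    bcol (sB s') j + posz (- sB s (lshift p i) j) *: bcol (sB s') i.
  by rewrite -Bij -(emap_mutB t_sign cLB' ji) /= (mutB_involutive t_sign i cLB).
have bji : (d i)%:Z * bet d (sB s') i 0 (lshift p j) = - sB s (lshift p j) i.
  by rewrite bet_entry // Bji.
have di := d_gt0 i.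
move: sym tij EB bji Bij Bji.
set x := sB s (lshift p i) j; set y := sB s (lshift p j) i => sym tij EB bji Bij Bji.
have monE' c : mon s c = mon (mu i s') c by rewrite /s' mut_mut.
(* The entries $b_{ij}$ and $b_{ji}$ have opposite signs, so the sign of $b_{ij}$ tells at which end
   of the exchange relation for $x_i$ the power of $x_j$ is lowest. *)
have [x0|x0] := lerP 0 x.
  exists (sB s'); split.
  - rewrite EB; suff -> : posz (- x) = 0 by rewrite scale0r addr0.
    by rewrite /posz; case: ltrP => //; lia.
  - rewrite Bji opprK /posz; case: ltrP => // y0.
    case: (ltrP 0 x) => x1; first by have := opposite_sign sym tij x1; lia.
    have x00 : x = 0 by lia.
    move: sym; rewrite x00 mulr0 oppr0 => /eqP.
    by rewrite mulf_eq0 (negbTE (t_neq0 t_sign j)) => /eqP.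
  (* If $b_{ij}=0$, then $b_{ji}=0$ too and no end is strictly lowest; but then $c_i=0$ and mutation
     leaves the monomial unchanged. *)
  move=> c ci xc; have [x00|xN0] := eqVneq x 0.
    have c0 := xc x00; exists 0; last exact: mspan0.
    by rewrite addr0 emap_id // /s' mut_mon_id.
  rewrite monE'; apply: (mut_mon_lead vs' (coord_linear (lshift p j)) _ ci) => /=.
  have : y < 0 by apply: (opposite_sign sym tij); rewrite lt_neqAle eq_sym xN0.
  by move: bji di; move: (bet _ _ _ _ _) => z; clear; nia.
have y0 : 0 < y.
  rewrite -oppr_lt0; apply: (@opposite_sign (t i) (t j) (- x)) => //; last by rewrite oppr_gt0.
  by rewrite !mulrN sym.
exists (- sB s'); split.
- rewrite (emap_opp t_sign _ _ cLB') EB bcolE -addrA -scalerDl.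
  have -> : posz (- x) = - x by rewrite /posz; case: ltrP => //; lia.
  by rewrite addNr scale0r addr0.
- by rewrite mxE opprK Bji /posz; case: ltrP => //; lia.
move=> c ci _; rewrite monE'.
apply: (mut_mon_trail vs' (coord_linear (lshift p j)) _ ci) => /=.
by move: bji di y0; move: (bet _ _ _ _ _) => z; clear; nia.
Qed.

(** In the new seed the terms of the old $x_j'$ have lowest parts [q] times the terms of the new
    $x_j'$, with one [q] for all. Subtracting [q] times the new $x_j'$ leaves only degrees above
    $-1$ in $x_j$, hence a polynomial in $x_j$. *)
Lemma hull_exchange s i j : valid s -> j != i ->
  hull (mu i s) j (sx (mu j s) (lshift p j)).
Proof.
move=> vs ji; have vs' := valid_mut i vs; set s' := mu i s in vs' *.
have cLB := valid_compat vs; have cLB' := valid_compat vs'.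
have frX' := valid_frame vs'; have skew' := compat_skew cLB'.
have [B0 [B0b B0j expand]] := mon_expand_mut vs ji; rewrite -/s' in B0b expand.
set b := bet d (sB s) j; set E := emap (sB s) j (e_ j).
set b' := bet d (sB s') j; set E' := emap (sB s') j (e_ j).
have dj : (d j)%:Z != 0 by have := d_gt0 j; lia.
have B0bet : emap B0 i b = b'.
  have /eqP : (d j)%:Z *: (emap B0 i b - b') = 0.
    by rewrite scalerBr -emapZ !(bet_scale cLB, bet_scale cLB') B0b subrr.
  by rewrite scalemx_eq0 (negbTE dj) subr_eq0 => /eqP.
have lij : lshift p i != lshift p j by rewrite eq_lshift eq_sym.
have lji : lshift p j != lshift p i by rewrite eq_lshift.
set f := emap B0 i E - E'.
have B0E (r : nat) : emap B0 i (E + r%:Z *: b) = f + (E' + r%:Z *: b').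
  by rewrite emapD emapZ B0bet /f addrA subrK.
have B0j' c : emap B0 i c 0 (lshift p j) = c 0 (lshift p j).
  by rewrite emapE (negbTE lji) B0j mul0r addr0.
have fj : f 0 (lshift p j) = 0.
  rewrite mxE B0j' [X in _ + X]mxE.
  have := exch_coord_main j 0 vs; have := exch_coord_main j 0 vs'.
  by rewrite !scale0r !addr0 => -> ->; rewrite opprK addNr.
(* The factor is independent of [r] because $f_j=0$ gives $\Lambda'(f,\beta'^j)=0$. *)
set q := v ^ (- lamform (sL s') f E') * mon s' f.
have hq : hull s' j q.
  apply: gr_mul; first exact: hull_v.
  by apply: (hull_mspan vs' _ (mspan_mem v _ (erefl f))) => _ <-; rewrite fj.
have vq : v * q = q * v.
  by apply: commrM; [apply: commrXz|apply: (frame_comm frX')].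
rewrite -(subrK (q * sx (mu j s') (lshift p j)) (sx (mu j s) _)).
apply: gr_add; last by apply: gr_mul => //; apply: hull_mut_main.
have -> : sx (mu j s) (lshift p j) - q * sx (mu j s') (lshift p j) =
    \sum_(r < (d j).+1) h j r * (mon s (E + r%:Z *: b) - q * mon s' (E' + r%:Z *: b')).
  rewrite (mut_var j vs) (mut_var j vs') mulr_sumr -sumrB; apply: eq_bigr => r _.
  have rd : (r <= d j)%N by rewrite -ltnS.
  by rewrite mulrA -(laurent_comm (h_laurent rd) vq) -mulrA -mulrBr.
apply: gen_ring_sum => r; have rd : (r <= d j)%N by rewrite -ltnS.
apply: gr_mul; first exact: (@hull_laurent s' j _ (h_laurent rd)).
have [||w -> Pw] := expand (E + r%:Z *: b).
- exact: exch_coord_ge0.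
- move=> Bij; rewrite mxE emapE (negbTE lij) Bij oppr0 unitvE (negbTE lij) /=.
  by rewrite mul0r addr0 add0r mxE betE Bij div0z mulr0.
have -> : mon s' (emap B0 i (E + r%:Z *: b)) = q * mon s' (E' + r%:Z *: b').
  rewrite B0E (frame_add v_unit frX') lamformDr lamformZr (lamform_bet0 d_gt0 cLB') //.
  by rewrite mulr0 addr0 mulrA.
rewrite addrC addKr; apply: hull_mspan Pw => // c.
by rewrite B0j' exch_coord_main // => cj; lia.
Qed.

(** All generators q-commute with $x_i$, and only $x_i^{-1}$ needs a power of $x_i$ to enter the new
    ring. *)
Lemma hull_clear_denominator s i j y : valid s -> j != i ->
  hull s j y -> exists M, hull (mu i s) j (y * sx s (lshift p i) ^+ M).
Proof.
move=> vs ji hy; have vs' := valid_mut i vs; set s' := mu i s in vs' *.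
set x := sx s (lshift p i).
have lij : lshift p i != lshift p j by rewrite eq_lshift eq_sym.
have lji : lshift p j != lshift p i by rewrite eq_lshift.
have xU : x \is a GRing.unit by apply: seed_var_unit.
have vx : v * x = x * v by apply: seed_var_commv.
have hx : hull s' j x.
  rewrite /x -(mut_mut i vs) -/s'.
  apply: (hull_mspan (P := fun c => 0 <= c 0 (lshift p j)) vs') => //.
  by apply: mut_var_span => // r rd; apply: exch_coord_ge0.
(* The bound has to serve all [N]: in a product the right factor is conjugated by the power of $x_i$
   that clears the left one. *)
pose good g := exists M : nat, forall N : nat, hull s' j (x ^ (- N%:Z) * g * x ^+ (N + M)).
suff [M /(_ 0%N) HM] : good y by exists M; move: HM; rewrite oppr0 expr0z mul1r add0n.
have qgood g (a : int) M : g * x = v ^ a * (x * g) -> v * g = g * v ->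
    hull s' j (g * x ^+ M) -> good g.
  move=> gx vg hg; exists M => N.
  have xg : x * g = v ^ (- a) * (g * x) by rewrite gx mulrA vexpVK // mul1r.
  rewrite (qcomm_expz v_unit _ xU vx vg xg) -!mulrA; apply: gr_mul; first exact: hull_v.
  by rewrite exprD [x ^ _ * (_ * _)]mulrA -exprnN mulVr ?unitrX // mul1r.
elim: hy => {y} [y Sy||y _ [M HM]|y z _ [My Hy] _ [Mz Hz]|y z _ [My Hy] _ [Mz Hz]].
- have vc k := seed_var_commv vs k.
  case: Sy => [->|[->|[[k kj yk]|[->|->]]]].
  + apply: (qgood _ 0 0%N) => //; first by rewrite expr0z mul1r vx.
    by rewrite mulr1; have := hull_v s' j 1; rewrite expr1z.
  + apply: (qgood _ 0 0%N) => //.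
    * by rewrite expr0z mul1r; apply/commr_sym/commrV/commr_sym.
    * by rewrite mulrV // mulVr.
    by rewrite mulr1; have := hull_v s' j (-1); rewrite exprN1.
  + have vyk : v * y = y * v by case: yk => ->; [|apply: commrV]; apply: vc.
    have [a ya] : exists a : int, y * x = v ^ a * (x * y).
      by case: yk => ->; [apply: seed_var_qcomm|apply: seed_var_inv_qcomm].
    have [ki|ki] := eqVneq k (lshift p i).
      case: yk => yE; rewrite yE ki in ya vyk *.
        by apply: (qgood _ a 0%N) => //; rewrite mulr1.
      by apply: (qgood _ a 1%N) => //; rewrite expr1 mulVr //; apply: gr_one.
    apply: (qgood _ a 0%N) => //; rewrite mulr1.
    rewrite -(sx_mut_neq s ki) -/s' in yk.
    by case: yk => ->; [apply: hull_side|apply: hull_side_inv].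
  + have [a ya] := seed_var_qcomm vs (lshift p j) (lshift p i).
    apply: (qgood _ a 0%N) => //; rewrite mulr1 -(sx_mut_neq s lji).
    exact: hull_main.
  have vj := valid_mut j vs.
  have [a ya] := seed_var_qcomm vj (lshift p j) (lshift p i).
  rewrite (sx_mut_neq s lij) in ya.
  apply: (qgood _ a 0%N) => //; first exact: seed_var_commv.
  by rewrite mulr1; apply: hull_exchange.
- by exists 0%N => N; rewrite mulr1 addn0 -exprnN mulVr ?unitrX //; apply: gr_one.
- by exists M => N; rewrite mulrN mulNr; apply: gr_opp; apply: HM.
- exists (My + Mz)%N => N; rewrite mulrDr mulrDl; apply: gr_add.
    by rewrite addnA exprD mulrA; apply: gr_mul; [apply: Hy|apply: gen_ringX].
  by rewrite (addnC My) addnA exprD mulrA; apply: gr_mul; [apply: Hz|apply: gen_ringX].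
exists (My + Mz)%N => N.
have -> : x ^ (- N%:Z) * (y * z) * x ^+ (N + (My + Mz)) =
    (x ^ (- N%:Z) * y * x ^+ (N + My)) *
    (x ^ (- (N + My)%N%:Z) * z * x ^+ (N + My + Mz)).
  rewrite -!exprnN -!mulrA [x ^+ (N + My) * (_ * _)]mulrA mulrV ?unitrX // mul1r.
  by rewrite addnA.
by apply: gr_mul; [apply: Hy|apply: Hz].
Qed.

Lemma hull_cancel_var s i j y : valid s -> j != i ->
  tspan (mu i s) y -> hull (mu i s) j (y * sx s (lshift p i)) -> hull (mu i s) j y.
Proof.
move=> vs ji; have vs' := valid_mut i vs; set s' := mu i s in vs' *.
have lij : lshift p i != lshift p j by rewrite eq_lshift eq_sym.
have lji : lshift p j != lshift p i by rewrite eq_lshift.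
have cLB' := valid_compat vs'.
have hx : hull s' j (sx s (lshift p i)).
  rewrite -(mut_mut i vs) -/s'.
  apply: (hull_mspan (P := fun c => 0 <= c 0 (lshift p j)) vs') => //.
  by apply: mut_var_span => // r rd; apply: exch_coord_ge0.
set b := bet d (sB s') i; set E := emap (sB s') i (e_ i).
have bj : (d i)%:Z * b 0 (lshift p j) = sB s' (lshift p j) i by apply: bet_entry.
have Ej : E 0 (lshift p j) = posz (- sB s' (lshift p j) i).
  by rewrite /E emapE (negbTE lji) !unitvE (negbTE lji) eqxx add0r mulr1.
pose l (g : int) c := g * lamform (sL s') (e_ i) c.
have l_lin g : int_linear (l g).
  by move=> a c1 c2; rewrite /l lamformDr lamformZr; ring.
have lbj g : l g (bet d (sB s') j) = 0.
  by rewrite /l (lamform_bet0 d_gt0 cLB') ?mulr0 // unitvE (negbTE lji).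
have lb_neq0 : l 1 b != 0.
  rewrite /l mul1r; apply/eqP => l0; have := lamform_bet cLB' i (e_ i).
  rewrite -/b l0 mulr0 unitvE eqxx mulr1 => /esym/eqP.
  by rewrite (negbTE (t_neq0 t_sign i)).
(* The sign [g] makes the degree increase along $\beta^i$, so $r=0$ is lowest for [l g] and $r=d_i$
   for [l (- g)]. *)
have [g lgb] : exists g, 0 < l g b.
  case: (ltrP 0 (l 1 b)) => lb; first by exists 1.
  by exists (-1); move: lb lb_neq0; rewrite /l; lia.
have lgE f (r : nat) : int_linear f -> f (E + r%:Z *: b) = f E + r%:Z * f b.
  by move=> fl; rewrite addrC fl addrC.
move=> Ty; rewrite -(mut_mut i vs) -/s'.
(* The end monomials of $x_i$ contain $x_j$ with exponents $[-b_{ji}]_+$ and $[b_{ji}]_+$; the one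
   with exponent zero is taken as lowest term. *)
have [Bji|Bji] := lerP 0 (sB s' (lshift p j) i).
  have [w xw Pw] := mut_var_lead i vs'; rewrite -/E -/b in xw Pw.
  rewrite xw; apply: (@hull_cancel s' j (l g)) => //.
  - by rewrite Ej /posz; case: ltrP => //; lia.
  - by apply: mspan_le Pw => _ [r r0 ->]; rewrite lgE // ltrDl mulr_gt0.
  by rewrite -xw mut_mut.
have [w xw Pw] := mut_var_trail i vs'; rewrite -/E -/b in xw Pw.
rewrite xw; apply: (@hull_cancel s' j (l (- g))) => //.
- rewrite mxE Ej [X in _ + X]mxE bj /posz; case: ltrP; lia.
- apply: mspan_le Pw => _ [r r0 ->]; rewrite !lgE // ltrD2l.
  have lN c : l (- g) c = - l g c by rewrite /l mulNr.
  by rewrite lN !mulrN ltrN2 ltr_pM2r // ltz_nat.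
by rewrite -xw mut_mut.
Qed.

(** * Invariance of boundedness and the Laurent phenomenon *)

Lemma tspan_mut_mut s i j y : valid s -> j != i ->
  tspan s y -> tspan (mu i s) y -> tspan (mu j s) y -> tspan (mu j (mu i s)) y.
Proof.
move=> vs ji Ty Tiy Tjy; have vs' := valid_mut i vs.
apply: (hull_tspan_mut vs'); set x := sx s (lshift p i).
have Tx : tspan (mu i s) x.
  have := @mut_var_span _ i vs' (fun _ => True) (fun _ _ => I).
  by rewrite mut_mut.
have [M hyM] := hull_clear_denominator vs ji (tspan_adjacent vs Ty Tjy).
rewrite -/x in hyM.
elim: M y {Ty Tjy} Tiy hyM => [|M IH] y Ty; first by rewrite mulr1.
rewrite exprS mulrA => /IH hyx; apply: hull_cancel_var => //; apply: hyx.
exact: (mspan_mul v_unit (valid_frame vs') _ Ty Tx).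
Qed.

Definition upper_bound s y := tspan s y /\ forall k, tspan (mu k s) y.

Lemma upper_bound_mut s i y : valid s -> upper_bound s y -> upper_bound (mu i s) y.
Proof.
move=> vs [Ty Tmy]; split=> // j; have [->|ji] := eqVneq j i; first by rewrite mut_mut.
exact: tspan_mut_mut.
Qed.

Lemma valid_mutseq s w : valid s -> valid (mutseq v d h s w).
Proof. by elim: w s => //= i w IH s vs; apply/IH/valid_mut. Qed.

Lemma upper_bound_mutseq s w y :
  valid s -> upper_bound s y -> upper_bound (mutseq v d h s w) y.
Proof.
elim: w s => //= i w IH s vs Us; apply: IH; first exact: valid_mut.
exact: upper_bound_mut.
Qed.

Lemma mutseq_rev s w : valid s -> mutseq v d h (mutseq v d h s w) (rev w) = s.
Proof.
rewrite /mutseq; elim/last_ind: w => // w i IH vs.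
by rewrite rev_rcons -cats1 foldl_cat /= mut_mut ?IH //; apply: valid_mutseq.
Qed.

Lemma upper_bound_var s k : valid s -> upper_bound s (sx s k).
Proof.
move=> vs; split=> [|i]; first by rewrite -mon_unitv; apply: mspan_mem.
have [->|ki] := eqVneq k (lshift p i); first exact/hull_tspan_mut/hull_main.
by rewrite -(sx_mut_neq s ki) -mon_unitv; apply: mspan_mem.
Qed.

Lemma sx_mutseq_frozen s w (k : 'I_p) :
  sx (mutseq v d h s w) (rshift n k) = sx s (rshift n k).
Proof.
elim: w s => //= i w IH s; rewrite IH sx_mut_neq //.
by rewrite eq_sym eq_lrshift.
Qed.

Lemma cluster_alg_sub_upper s y : valid s -> cluster_alg v d h s y -> upper_cluster v d h s y.
Proof.
move=> vs Ay _ [w ->]; have vw := valid_mutseq w vs.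
apply: gen_ring_le Ay => {y} y [->|[->|[[k yk]|[_ [k [[w' ->] ->]]]]]].
- by apply: gr_mem; left.
- by apply: gr_mem; right; left.
- by apply: gr_mem; right; right; exists (rshift n k); rewrite sx_mutseq_frozen.
apply: tspan_ZP_laurent => //.
have vw' := valid_mutseq w' vs.
(* The variable is bounded at its own seed; boundedness travels back to the initial seed and from
   there along [w]. *)
have := upper_bound_mutseq (rev w') vw' (upper_bound_var (lshift p k) vw').
by rewrite mutseq_rev // => /(upper_bound_mutseq w vs)[].
Qed.

End SeedMutation.

(** * The initial seed as a valid seed *)

Theorem theorem3p1 (D : unitRingType) (v : D) (n p : nat)
    (x0 : 'I_(n + p) -> D) (L : 'M[int]_(n + p)) (B : 'M[int]_(n + p, n))
    (d : 'I_n -> nat) (h : 'I_n -> nat -> D) :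
  (0 < n)%N ->
  (* D is a division ring *)
  (forall y : D, y != 0 -> y \is a GRing.unit) ->
  (* initial seed: X is an embedding of the quantum torus T(Lambda) *)
  (forall k, v * x0 k = x0 k * v) ->
  (forall c c' : 'rV[int]_(n + p),
      qmon v L x0 c * qmon v L x0 c' = v ^ lamform L c c' * qmon v L x0 (c + c')) ->
  torus_indep v L x0 ->
  (* compatible pair *)
  L^T = - L ->
  (exists dt : 'rV[int]_n,
      (forall l, 0 < dt 0 l) /\ L *m B = - col_mx (diag_mx dt) 0) ->
  (* the d_k *)
  (forall k, (0 < d k)%N) ->
  (forall (k : 'I_n) (j : 'I_(n + p)), ((d k)%:Z %| B j k)%Z) ->
  (* the coefficients h *)
  (forall k r, (r <= d k)%N -> laurent_v v (h k r)) ->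
  (forall k, h k 0%N = 1 /\ h k (d k) = 1) ->
  (forall k r, (r <= d k)%N -> h k r = h k (d k - r)%N) ->
  forall y, cluster_alg v d h (Seed x0 L B) y -> upper_cluster v d h (Seed x0 L B) y.
Proof.
move=> _ divD vx mulX indep skewL [dt [dt_gt0 LB]] d_gt0 dvdB h_laurent h_ends h_sym y Ay.
(* If [v] were zero, the single monomial $q^{1/2}X(0)$ would satisfy a relation with coefficient
   $1$. *)
have v_unit : v \is a GRing.unit.
  apply: divD; apply/eqP => v0.
  have inj : injective (fun _ : 'I_1 => (1 : int, 0 : 'rV[int]_(n + p))).
    by move=> a b _; rewrite !ord1.
  have := indep 1%N (fun=> 1) _ _ inj; rewrite big_ord1 expr1z v0 mul0r mulr0.
  by move=> /(_ erefl ord0).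
(* The sign comes from $\Lambda\widetilde B=-[D;0]$. *)
pose t (i : 'I_n) := - dt 0 i.
have t_sign i j : 0 < t i * t j by rewrite mulrNN mulr_gt0.
apply: (cluster_alg_sub_upper (t := t) divD v_unit t_sign) Ay => //; split; rewrite ?monE //=.
- exact: frame_of_qmon.
- exact: torus_indep_mindep.
split=> // i c.
have -> : bcol B i = (col i B)^T by apply/rowP => k; rewrite !mxE.
rewrite /lamform trmxK colE mulmxA -colE [LHS]mxE -mulmxA LB mulmxN mxE mxE.
rewrite (bigD1 (lshift p i)) //= big1 ?addr0 => [|k ki].
  by rewrite col_mxEu mxE eqxx mulr1n mulrC mulNr.
case: (split_ordP k) ki => l ->; last by rewrite col_mxEd mxE mulr0.
by rewrite eq_lshift col_mxEu mxE => /negbTE ->; rewrite mulr0n mulr0.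
Qed.
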